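(* Let $G$ be an arbitrary group, let $H=\bigoplus_{g\in G}H_g$ be a faithfully $G$-graded quasi-Hopf algebra over a field $\Bbbk$, let $N\unlhd G$ and let $J\subseteq H_e$ be a $G$-invariant quasi-Hopf ideal of $H_e$ such that $(N,J)$ admits an equivariant family; fix one such family $\{u_n\}_{n\in N}$ (the reference units). The assignments \[ (N,J,\gamma)\longmapsto I_\gamma:=\left\langle\,J^G,\ \widetilde u_n-\widetilde\gamma(n)\ \mid\ n\in N\,\right\rangle_H \qquad\text{and}\qquad I\longmapsto(N_I,\ I\cap H_e,\ \gamma) \] define a bijective correspondence between the set of character data for $H$ with first two components $N$ and $J$ and the set of quasi-Hopf ideals $I\subseteq H$ with $N_I=N$ and $I\cap H_e=J$. Here $\langle\cdots\rangle_H$ is the two-sided ideal of $H$ generated by the indicated elements, $\widetilde u_n\in H_n$ and $\widetilde\gamma(n)\in H_e$ are arbitrary lifts of $u_n$ and $\gamma(n)$, and in the second assignment $\gamma(n)=\tau(u_n)$, where $\tau\colon H_N/J^N\to H_e/J$ is the unique quasi-Hopf algebra retraction with kernel $(I\cap H_N)/J^N$.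
   Context: Conventions. $\Bbbk$ is a field; vector spaces, algebras and tensor products are over $\Bbbk$; algebras are unital and algebra (anti-)morphisms preserve units. For subspaces $U,V$ of an algebra, $UV$ is the linear span of the products $uv$. Summation is suppressed: $\Delta(x)=x'\otimes x''$, $\Phi=\Phi^{(1)}\otimes\Phi^{(2)}\otimes\Phi^{(3)}$, $\Phi^{-1}=\Phi^{(-1)}\otimes\Phi^{(-2)}\otimes\Phi^{(-3)}$. Quasi-Hopf algebras. A quasi-Hopf algebra is an algebra $H$ with algebra morphisms $\Delta\colon H\to H\otimes H$, $\varepsilon\colon H\to\Bbbk$, an invertible $\Phi\in H^{\otimes 3}$, an algebra anti-morphism $S\colon H\to H$ (not assumed bijective) and elements $\alpha,\beta\in H$ such that for all $x\in H$: $(1\otimes\Phi)(\mathrm{id}\otimes\Delta\otimes\mathrm{id})(\Phi)(\Phi\otimes1)=(\mathrm{id}\otimes\mathrm{id}\otimes\Delta)(\Phi)(\Delta\otimes\mathrm{id}\otimes\mathrm{id})(\Phi)$; $\Phi(\Delta\otimes\mathrm{id})(\Delta(x))=(\mathrm{id}\otimes\Delta)(\Delta(x))\Phi$; $(\mathrm{id}\otimes\varepsilon\otimes\mathrm{id})(\Phi)=1\otimes1$; $(\mathrm{id}\otimes\varepsilon)\Delta(x)=x=(\varepsilon\otimes\mathrm{id})\Delta(x)$; $S(x')\alpha x''=\varepsilon(x)\alpha$; $x'\beta S(x'')=\varepsilon(x)\beta$; $\Phi^{(1)}\beta S(\Phi^{(2)})\alpha\Phi^{(3)}=1=S(\Phi^{(-1)})\alpha\Phi^{(-2)}\beta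 S(\Phi^{(-3)})$. Throughout, $(\alpha,\beta)$ is normalized by $\varepsilon(\alpha)=\varepsilon(\beta)=1$. A morphism of quasi-Hopf algebras is an algebra morphism commuting with $\Delta,\varepsilon,S$ and carrying $\Phi,\alpha,\beta$ to $\Phi,\alpha,\beta$. A quasi-Hopf ideal of $H$ is a two-sided ideal $I$ with $\Delta(I)\subseteq I\otimes H+H\otimes I$, $\varepsilon(I)=0$, $S(I)\subseteq I$; then $H/I$ has a unique quasi-Hopf structure making $H\to H/I$ a morphism. An element $x$ is group-like if $\Delta(x)=x\otimes x$ and $\varepsilon(x)=1$. $G_{\mathrm c}(B)$ denotes the abelian group of invertible central group-like elements of a quasi-Hopf algebra $B$. Gradings. For a group $G$ with identity $e$, a $G$-graded quasi-Hopf algebra is a quasi-Hopf algebra with a vector space decomposition $H=\bigoplus_{g\in G}H_g$ such that $H_gH_h\subseteq H_{gh}$, $\Delta(H_g)\subseteq H_g\otimes H_g$, $S(H_g)\subseteq H_{g^{-1}}$, $\Phi\in H_e^{\otimes3}$, $\alpha,\beta\in H_e$. It is faithfully graded if $H_g\neq0$ for all $g$, and strongly graded if $H_gH_h=H_{gh}$ for all $g,h$ (a faithful grading of a quasi-Hopf algebra is automatically strong). The group algebra $\Bbbk[G]$ has basis $\{\zeta_g\}_{g\in G}$, $\zeta_g\zeta_h=\zeta_{gh}$. The grading map of $H$ is $\pi\colon H\to\Bbbk[G]$, $\pi(x_g)=\varepsilon(x_g)\zeta_g$ for $x_g\in H_g$. For a quasi-Hopf ideal $I$ of $H$, $N_I$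 is the unique normal subgroup of $G$ with $\pi(I)=\mathfrak{a}_{N_I}\cdot\Bbbk[G]$, where $\mathfrak{a}_N$ is the span of $\zeta_n-\zeta_e$, $n\in N$; explicitly $N_I=\{g\in G\mid\zeta_g-\zeta_e\in\pi(I)\}$. Lifted quotients. For $N\unlhd G$ put $H_N=\bigoplus_{n\in N}H_n$, a quasi-Hopf subalgebra. An ideal $J$ of $H_e$ is $G$-invariant if $H_gJ=JH_g$ for all $g\in G$. For a $G$-invariant quasi-Hopf ideal $J\subseteq H_e$, $J^G:=HJ=\sum_gH_gJ$ and $J^N:=H_NJ$ are quasi-Hopf ideals of $H$ and $H_N$, with $J^N=J^G\cap H_N$, $J^N\cap H_e=J$. Let $q_J\colon H\to H/J^G$ be the projection; $H/J^G$ is strongly $G$-graded with components $q_J(H_g)$. The lifted quotient $H_N/J^N$, identified with $q_J(H_N)$, is strongly $N$-graded with neutral component identified with $H_e/J$. A quasi-Hopf algebra retraction $H_N/J^N\to H_e/J$ is a morphism of quasi-Hopf algebras that is the identity on $H_e/J$. For every quasi-Hopf ideal $I$ with $N_I=N$, $I\cap H_e=J$, there is a unique such retraction with kernel $(I\cap H_N)/J^N$. Conjugation. For $g\in G$ and $x\in H/J^G$ commuting with $H_e/J$, set ${}^{g}x:=\sum_i\bar h_i x\bar h_i'$, where $\sum_i\bar h_i\bar h_i'=1$ is any finite decomposition with $\bar h_i\in q_J(H_g)$, $\bar h_i'\in q_J(H_{g^{-1}})$; this is independent of the decomposition, and it defines an action of $G$ on the group $G_{\mathrm c}(H_e/J)$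 by group automorphisms. Equivariant families and character data. A group-like splitting of the grading of $H_N/J^N$ is a family $(u_n)_{n\in N}$ of group-like units $u_n$ of degree $n$ with $u_nu_m=u_{nm}$ and $u_nb=bu_n$ for all $b\in H_e/J$. An equivariant family for $(N,J)$ is a group-like splitting with ${}^{g}u_n=u_{gng^{-1}}$ for all $g\in G$, $n\in N$. A character datum for $H$ is a triple $(N,J,\gamma)$ with $N\unlhd G$, $J\subseteq H_e$ a $G$-invariant quasi-Hopf ideal such that $(N,J)$ admits an equivariant family, and $\gamma\colon N\to G_{\mathrm c}(H_e/J)$ a group homomorphism satisfying ${}^{g}\gamma(n)=\gamma(gng^{-1})$ for all $g\in G$, $n\in N$. *)

(* Defs.v *)
Set Warnings "-notation-overridden,-ambiguous-paths,-redundant-canonical-projection,-notation-incompatible-prefix,-projection-no-head-constant".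

From HB Require Import structures.
From mathcomp Require Import all_boot all_algebra generic_quotient.
From mathcomp Require Import boolp classical_sets monalg.

Set Implicit Arguments.
Unset Strict Implicit.
Unset Printing Implicit Defensive.

Import GRing.Theory.

Local Open Scope classical_set_scope.
Local Open Scope ring_scope.
Local Open Scope quotient_scope.

Reserved Notation "A \ot B" (at level 38, right associativity).

(* The tensor product is the commutative monoid of formal sums of pairs (u, v),
   represented by sequences, modulo the usual relations; the sum is induced by
   concatenation, and the opposite of (u, v) is (- u, v). *)
Section Tensor.
Variables (k : pzRingType) (U V : lmodType k).

Inductive tensor_rel : seq (U * V) -> seq (U * V) -> Prop :=
| tensor_refl s : tensor_rel s s
| tensor_sym s t : tensor_rel s t -> tensor_rel t s
| tensor_trans s t r : tensor_rel s t -> tensor_rel t r -> tensor_rel s r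
| tensor_cat s s' t t' :
    tensor_rel s s' -> tensor_rel t t' -> tensor_rel (s ++ t) (s' ++ t')
| tensor_comm s t : tensor_rel (s ++ t) (t ++ s)
| tensor_zero v : tensor_rel [:: (0, v)] [::]
| tensor_addl u u' v : tensor_rel [:: (u + u', v)] [:: (u, v); (u', v)]
| tensor_addr u v v' : tensor_rel [:: (u, v + v')] [:: (u, v); (u, v')]
| tensor_scale c u v : tensor_rel [:: (c *: u, v)] [:: (u, c *: v)].

Definition tensor_eq (s t : seq (U * V)) : bool := `[< tensor_rel s t >].

Lemma tensor_eq_equiv : equiv_class_of tensor_eq.
Proof.
split.
- by move=> s; apply/asboolP; exact: tensor_refl.
- by move=> s t; apply/asboolP/asboolP => /tensor_sym.
- by move=> s t r /asboolP h1 /asboolP h2; apply/asboolP/(tensor_trans h1 h2).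
Qed.

Canonical tensor_equiv := EquivRelPack tensor_eq_equiv.
Canonical tensor_encModRel := defaultEncModRel tensor_eq.

Definition tensor : Type := {eq_quot tensor_eq}.
HB.instance Definition _ := Choice.on tensor.

Definition tmk (s : seq (U * V)) : tensor := \pi_{eq_quot tensor_eq} s.
Definition tens (u : U) (v : V) : tensor := tmk [:: (u, v)].

Lemma tmkP s t : tmk s = tmk t <-> tensor_rel s t.
Proof.
rewrite /tmk; split=> [/eqP|h]; first by rewrite eqmodE => /asboolP.
by apply/eqP; rewrite eqmodE; apply/asboolP.
Qed.

Lemma tmk_repr t : tmk (repr (t : {eq_quot tensor_eq})) = t.
Proof. by rewrite /tmk reprK. Qed.

Lemma tmk_rep_rel s : tensor_rel (repr (tmk s : {eq_quot tensor_eq})) s.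
Proof. by apply/tmkP; rewrite tmk_repr. Qed.

Definition trep (t : tensor) : seq (U * V) := repr (t : {eq_quot tensor_eq}).

Lemma trepK t : tmk (trep t) = t. Proof. exact: tmk_repr. Qed.

Lemma trep_tmk s : tensor_rel (trep (tmk s)) s. Proof. exact: tmk_rep_rel. Qed.

Definition tmapseq (f : U -> U) (s : seq (U * V)) := [seq (f p.1, p.2) | p <- s].

Lemma tmapseq_rel (f : U -> U) s t : f 0 = 0 -> {morph f : x y / x + y} ->
  (forall c, {morph f : x / c *: x}) ->
  tensor_rel s t -> tensor_rel (tmapseq f s) (tmapseq f t).
Proof.
move=> f0 fD fZ; elim=> {s t}.
- by move=> s; exact: tensor_refl.
- by move=> s t _ /tensor_sym.
- by move=> s t r _ h1 _; apply: tensor_trans.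
- by move=> s s' t t' _ h1 _ h2; rewrite /tmapseq !map_cat; apply: tensor_cat.
- by move=> s t; rewrite /tmapseq !map_cat; apply: tensor_comm.
- by move=> v; rewrite /= f0; apply: tensor_zero.
- by move=> u u' v; rewrite /= fD; apply: tensor_addl.
- by move=> u v v'; apply: tensor_addr.
- by move=> c u v; rewrite /= fZ; apply: tensor_scale.
Qed.

Definition tadd (x y : tensor) := tmk (trep x ++ trep y).
Definition topp (x : tensor) := tmk (tmapseq -%R (trep x)).

Lemma tmk_cat s t : tmk (s ++ t) = tadd (tmk s) (tmk t).
Proof.
by apply/tmkP; apply: tensor_cat; apply: tensor_sym; apply: trep_tmk.
Qed.

Lemma tmk_opp s : tmk (tmapseq -%R s) = topp (tmk s).
Proof.
apply/tmkP; apply: tmapseq_rel.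
- exact: oppr0.
- exact: opprD.
- by move=> c x; rewrite scalerN.
- exact/tensor_sym/trep_tmk.
Qed.

Lemma taddA : associative tadd.
Proof.
by move=> x y z; rewrite -[x]trepK -[y]trepK -[z]trepK -!tmk_cat catA.
Qed.

Lemma taddC : commutative tadd.
Proof. by move=> x y; apply/tmkP/tensor_comm. Qed.

Lemma tadd0 : left_id (tmk [::]) tadd.
Proof. by move=> x; rewrite -[x]trepK -tmk_cat. Qed.

Lemma taddN : left_inverse (tmk [::]) topp tadd.
Proof.
move=> x; rewrite -[x]trepK -tmk_opp.
elim: (trep x) => [|[u v] s IHs]; first by rewrite tadd0.
rewrite /= -cat1s -(cat1s (u, v) s) !tmk_cat.
rewrite [tadd (tmk [:: (u, v)]) _]taddC -taddA [tadd (tmk (tmapseq _ _)) _]taddA.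
rewrite IHs tadd0 -tmk_cat /=.
apply/tmkP; apply: tensor_trans (tensor_zero v).
by rewrite -(addNr u); apply/tensor_sym/tensor_addl.
Qed.

HB.instance Definition _ := GRing.isZmodule.Build tensor taddA taddC tadd0 taddN.

Lemma tmk0 : tmk [::] = 0. Proof. by []. Qed.

Lemma tmkD s t : tmk (s ++ t) = tmk s + tmk t.
Proof. exact: tmk_cat. Qed.

Lemma tmkE s : tmk s = \sum_(p <- s) tens p.1 p.2.
Proof.
elim: s => [|[u v] s IHs]; first by rewrite big_nil.
by rewrite -cat1s tmkD IHs big_cons.
Qed.

Lemma tensDl u u' v : tens (u + u') v = tens u v + tens u' v.
Proof. by rewrite -tmkD; apply/tmkP/tensor_addl. Qed.

Lemma tensDr u v v' : tens u (v + v') = tens u v + tens u v'.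
Proof. by rewrite -tmkD; apply/tmkP/tensor_addr. Qed.

Lemma tens_scale c u v : tens (c *: u) v = tens u (c *: v).
Proof. exact/tmkP/tensor_scale. Qed.

Lemma tensorP (t : tensor) :
  exists s : seq (U * V), t = \sum_(p <- s) tens p.1 p.2.
Proof. by exists (trep t); rewrite -tmkE trepK. Qed.

(* The linear map induced by f on the tensor product: this is the Sweedler-style
   sum of the f t' t'' over a representative of t, and is meaningful (that is,
   independent of the representative) when f is bilinear. *)
Definition tlift (W : nmodType) (f : U -> V -> W) (t : tensor) : W :=
  \sum_(p <- trep t) f p.1 p.2.

Definition bilinear_over (W : zmodType) (f : U -> V -> W) : Prop :=
  [/\ forall v, {morph f^~ v : x y / x + y},
      forall u, {morph f u : x y / x + y}
    & forall c u v, f (c *: u) v = f u (c *: v)].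

Section Lift.
Variables (W : zmodType) (f : U -> V -> W).
Hypothesis fB : bilinear_over f.

Lemma tensor_rel_sum s t : tensor_rel s t ->
  \sum_(p <- s) f p.1 p.2 = \sum_(p <- t) f p.1 p.2.
Proof.
have [fDl fDr fZ] := fB; elim=> {s t}.
- by [].
- by move=> s t _ ->.
- by move=> s t r _ -> _ ->.
- by move=> s s' t t' _ h1 _ h2; rewrite !big_cat /= h1 h2.
- by move=> s t; rewrite !big_cat /= addrC.
- move=> v; rewrite big_seq1 big_nil /=.
  by apply: (addrI (f 0 v)); rewrite addr0 -fDl addr0.
- by move=> u u' v; rewrite !big_cons !big_nil /= fDl !addr0.
- by move=> u v v'; rewrite !big_cons !big_nil /= fDr !addr0.
- by move=> c u v; rewrite !big_seq1 fZ.
Qed.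

Lemma tlift_tmk s : tlift f (tmk s) = \sum_(p <- s) f p.1 p.2.
Proof. exact/tensor_rel_sum/trep_tmk. Qed.

Lemma tliftE u v : tlift f (tens u v) = f u v.
Proof. by rewrite tlift_tmk big_seq1. Qed.

Lemma tliftD : {morph tlift f : x y / x + y}.
Proof.
by move=> x y; rewrite -[x]trepK -[y]trepK -tmkD !tlift_tmk big_cat.
Qed.

Lemma tlift0 : tlift f 0 = 0.
Proof. by rewrite -tmk0 tlift_tmk big_nil. Qed.

End Lift.

Lemma tensor_ind (P : tensor -> Prop) :
  P 0 -> (forall x y, P x -> P y -> P (x + y)) -> (forall u v, P (tens u v)) ->
  forall t, P t.
Proof.
move=> P0 PD Pt t; have [s ->] := tensorP t.
by elim/big_ind: _ => // p _.
Qed.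

End Tensor.

Section TensorLmodule.
Variables (k : comPzRingType) (U V : lmodType k).
Local Notation T := (tensor U V).

Definition tscale (c : k) : T -> T := tlift (fun u v => tens (c *: u) v).

Lemma tscale_bilinear c : bilinear_over (fun (u : U) (v : V) => tens (c *: u) v).
Proof.
split=> [v x y|u x y|d u v] /=.
- by rewrite scalerDr tensDl.
- by rewrite tensDr.
- by rewrite !tens_scale !scalerA mulrC.
Qed.

Lemma tscale_tens c u v : tscale c (tens u v) = tens (c *: u) v.
Proof. exact: (tliftE (tscale_bilinear c)). Qed.

Lemma tscaleDr c : {morph tscale c : x y / x + y}.
Proof. exact: tliftD (tscale_bilinear c). Qed.

Lemma tscale0 c : tscale c 0 = 0.
Proof. exact: tlift0 (tscale_bilinear c). Qed.

Lemma tscaleA a b t : tscale a (tscale b t) = tscale (a * b) t.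
Proof.
elim/tensor_ind: t => [|x y hx hy|u v]; first by rewrite !tscale0.
  by rewrite !tscaleDr hx hy.
by rewrite !tscale_tens scalerA.
Qed.

Lemma tscale1 : left_id 1 tscale.
Proof.
elim/tensor_ind => [|x y hx hy|u v]; first by rewrite tscale0.
  by rewrite tscaleDr hx hy.
by rewrite tscale_tens scale1r.
Qed.

Lemma tscaleDl t : {morph tscale^~ t : a b / a + b}.
Proof.
move=> a b; elim/tensor_ind: t => [|x y hx hy|u v] /=.
- by rewrite !tscale0 addr0.
- by rewrite !tscaleDr hx hy addrACA.
- by rewrite !tscale_tens scalerDl tensDl.
Qed.

HB.instance Definition _ :=
  GRing.Zmodule_isLmodule.Build k T tscaleA tscale1 tscaleDr tscaleDl.

Lemma tensZl c u v : tens (c *: u) v = c *: (tens u v : T).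
Proof. by rewrite -tscale_tens. Qed.

Lemma tensZr c u v : tens u (c *: v) = c *: (tens u v : T).
Proof. by rewrite -tens_scale tensZl. Qed.

Lemma tlift_linear (W : lmodType k) (f : U -> V -> W) :
  bilinear_over f -> (forall c u v, f (c *: u) v = c *: f u v) ->
  linear (tlift f).
Proof.
move=> fB fZ c x y; rewrite (tliftD fB); congr (_ + _).
elim/tensor_ind: x => [|x z hx hz|u v].
- by rewrite scaler0 (tlift0 fB) scaler0.
- by rewrite scalerDr !(tliftD fB) hx hz scalerDr.
- by rewrite -tensZl !(tliftE fB) fZ.
Qed.

End TensorLmodule.

Arguments tensor {k} U%_type V%_type.
Notation "U \ot V" := (tensor U V) : type_scope.
Notation "u \ot v" := (tens u v) : ring_scope.

Section TensorMap.
Variables (k : comPzRingType) (U V U' V' : lmodType k).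

Definition tmap (f : U -> U') (g : V -> V') : U \ot V -> U' \ot V' :=
  tlift (fun u v => f u \ot g v).

Variables (f : {linear U -> U'}) (g : {linear V -> V'}).

Lemma tmap_bilinear : bilinear_over (fun u v => f u \ot g v).
Proof.
split=> [v x y|u x y|c u v] /=; first by rewrite linearD tensDl.
  by rewrite linearD tensDr.
by rewrite !linearZ /= tens_scale.
Qed.

Lemma tmapE u v : tmap f g (u \ot v) = f u \ot g v.
Proof. exact: (tliftE tmap_bilinear). Qed.

Lemma tmap_is_linear : linear (tmap f g).
Proof.
apply: tlift_linear; first exact: tmap_bilinear.
by move=> c u v; rewrite linearZ tensZl.
Qed.

HB.instance Definition _ :=
  GRing.isLinear.Build k (tensor U V) (tensor U' V') _ (tmap f g) tmap_is_linear.

End TensorMap.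

Section TensorAssoc.
Variables (k : comPzRingType) (U V W : lmodType k).

Definition tassoc : (U \ot V) \ot W -> U \ot (V \ot W) :=
  tlift (fun t w => tlift (fun u v => u \ot (v \ot w)) t).

Lemma tassoc_bilinear0 w :
  bilinear_over (fun (u : U) (v : V) => u \ot (v \ot (w : W))).
Proof.
split=> [v x y|u x y|c u v]; first by rewrite tensDl.
  by rewrite !(tensDl, tensDr).
by rewrite tensZl tensZl tensZr.
Qed.

Lemma tassoc_bilinear :
  bilinear_over
    (fun (t : U \ot V) (w : W) => tlift (fun u v => u \ot (v \ot w)) t).
Proof.
split=> [w x y|t x y|c t w] /=; first by rewrite (tliftD (tassoc_bilinear0 w)).
  elim/tensor_ind: t => [|t t' ht ht'|u v].
  - by rewrite !(tlift0 (tassoc_bilinear0 _)) addr0.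
  - by rewrite !(tliftD (tassoc_bilinear0 _)) ht ht' addrACA.
  - by rewrite !(tliftE (tassoc_bilinear0 _)) !tensDr.
elim/tensor_ind: t => [|t t' ht ht'|u v].
- by rewrite scaler0 !(tlift0 (tassoc_bilinear0 _)).
- by rewrite scalerDr !(tliftD (tassoc_bilinear0 _)) ht ht'.
- by rewrite -tensZl !(tliftE (tassoc_bilinear0 _)) !(tensZl, tensZr).
Qed.

Lemma tassocE u v w : tassoc ((u \ot v) \ot w) = u \ot (v \ot w).
Proof.
by rewrite /tassoc (tliftE tassoc_bilinear) (tliftE (tassoc_bilinear0 _)).
Qed.

Lemma tassoc_is_linear : linear tassoc.
Proof.
apply: tlift_linear; first exact: tassoc_bilinear.
move=> c t w.
have h : linear (tlift (fun (u : U) (v : V) => u \ot (v \ot w))).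
  by apply: (tlift_linear (tassoc_bilinear0 w)) => d u v; rewrite tensZl.
by have := h c t 0; rewrite (tlift0 (tassoc_bilinear0 w)) !addr0.
Qed.

HB.instance Definition _ :=
  GRing.isLinear.Build k (tensor (tensor U V) W) (tensor U (tensor V W)) _ tassoc
    tassoc_is_linear.

End TensorAssoc.
Arguments tassoc {k U V W} _.

(* Every nonzero vector of a vector space is mapped to 1 by some linear form;
   this is what makes A \ot B a nonzero ring. *)
Lemma ex_linear_form (k : fieldType) (V : lmodType k) (v : V) : v != 0 ->
  exists2 phi : V -> k, (forall c x y, phi (c *: x + y) = c * phi x + phi y)
                      & phi v = 1.
Proof.
move=> v0.
pose P (W : set V) :=
  (forall c x y, W x -> W y -> W (c *: x + y)) /\ ~ W v.
have [|W [[Wl Wv] Wmax]] := @Zorn_bigcup V P.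
  move=> F FP Ftot; split; last by move=> [X /FP [_ XNv] /XNv].
  move=> c x y [X FX Xx] [Y FY Yy].
  have [XY|YX] := Ftot _ _ FX FY.
    by exists Y => //; apply: (FP _ FY).1 => //; apply: XY.
  by exists X => //; apply: (FP _ FX).1 => //; apply: YX.
have W0 : W 0.
  apply: contrapT => W0.
  have WE x : ~ W x by move=> Wx; apply: W0; rewrite -(addNr x) -scaleN1r; apply: Wl.
  apply: (Wmax [set 0]); last first.
    split=> [c x y /= -> ->|/= /eqP]; first by rewrite scaler0 addr0.
    by rewrite (negPf v0).
  by split=> [x /WE|/(_ 0 erefl)].
have WZ c x : W x -> W (c *: x) by move=> Wx; rewrite -[_ *: _]addr0; apply: Wl.
have WD x y : W x -> W y -> W (x + y).
  by move=> Wx Wy; rewrite -[x]scale1r; apply: Wl.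
have ex x : exists c, W (x - c *: v).
  have [Wx|NWx] := pselect (W x); first by exists 0; rewrite scale0r subr0.
  pose B := [set y | exists2 w, W w & exists a, y = w + a *: x].
  have /not_andP [BN|/contrapT [w Ww [a va]]] : ~ P B.
  - apply: Wmax; split=> [w Ww|/(_ x)]; first by exists w => //; exists 0; rewrite scale0r addr0.
    by move=> WB; apply: NWx; apply: WB; exists 0 => //; exists 1; rewrite scale1r add0r.
  - exfalso; apply: BN => c y z [w Ww [a ->]] [w' Ww' [a' ->]].
    exists (c *: w + w'); first exact: Wl.
    by exists (c * a + a'); rewrite scalerDr scalerDl scalerA addrACA.
  have a0 : a != 0.
    by apply/eqP => a0; apply: Wv; rewrite va a0 scale0r addr0.
  exists a^-1; rewrite va scalerDr scalerA mulVf // scale1r opprD addrCA subrr.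
  by rewrite addr0 -scaleNr; apply: WZ.
have uniq x c d : W (x - c *: v) -> W (x - d *: v) -> c = d.
  move=> hc hd; apply: contrapT => /eqP cd; apply: Wv.
  have -> : v = (c - d)^-1 *: ((x - d *: v) - (x - c *: v)).
    rewrite opprB [(x - _) + _]addrC addrA subrK -scalerBl scalerA.
    by rewrite mulVf ?scale1r ?subr_eq0.
  apply: (WZ); apply: WD => //; rewrite -scaleN1r; exact: WZ.
pose phi x := xget 0 [set c | W (x - c *: v)].
have phiP x : W (x - phi x *: v) by exact: (xgetPex 0 (ex x)).
exists phi => [c x y|].
  apply: (uniq (c *: x + y)) => //.
  rewrite scalerDl opprD addrACA -scalerA -scalerBr; apply: WD => //; exact: WZ.
by apply: (uniq v) => //; rewrite scale1r subrr.
Qed.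

Section TensorAlgebra.
Variables (k : fieldType) (A B : algType k).
Local Notation AB := (tensor A B).

Definition tmul (x y : AB) : AB :=
  tlift (fun a b => tmap ( *%R a) ( *%R b) y) x.

Let tmap_mul_bilinear (a : A) (b : B) :
  bilinear_over (fun a' b' => (a * a') \ot (b * b')).
Proof.
split=> [b' x y|a' x y|c a' b'] /=; first by rewrite mulrDr tensDl.
  by rewrite mulrDr tensDr.
by rewrite -!scalerAr tens_scale.
Qed.

Let tmap_mulE a b a' b' :
  tmap ( *%R a) ( *%R b) (a' \ot b' : AB) = (a * a') \ot (b * b').
Proof. exact: (tliftE (tmap_mul_bilinear a b)). Qed.

Let tmap_mulD a b : {morph (tmap ( *%R a) ( *%R b) : AB -> AB) : x y / x + y}.
Proof. exact: tliftD (tmap_mul_bilinear a b). Qed.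

Let tmap_mul0 a b : tmap ( *%R a) ( *%R b) (0 : AB) = 0.
Proof. exact: tlift0 (tmap_mul_bilinear a b). Qed.

Let tmul_bilinear (y : AB) :
  bilinear_over (fun (a : A) (b : B) => tmap ( *%R a) ( *%R b) y).
Proof.
split=> [b a a'|a b b'|c a b] /=; elim/tensor_ind: y => [|x y hx hy|a0 b0].
- by rewrite !tmap_mul0 addr0.
- by rewrite !tmap_mulD hx hy addrACA.
- by rewrite !tmap_mulE mulrDl tensDl.
- by rewrite !tmap_mul0 addr0.
- by rewrite !tmap_mulD hx hy addrACA.
- by rewrite !tmap_mulE mulrDl tensDr.
- by rewrite !tmap_mul0.
- by rewrite !tmap_mulD hx hy.
- by rewrite !tmap_mulE -!scalerAl tens_scale.
Qed.

Let tmulE a b a' b' :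
  tmul (a \ot b) (a' \ot b') = (a * a') \ot (b * b').
Proof. by rewrite /tmul (tliftE (tmul_bilinear _)) tmap_mulE. Qed.

Let tmul0r x : tmul x 0 = 0.
Proof.
elim/tensor_ind: x => [|x y hx hy|a b].
- exact: (tlift0 (tmul_bilinear 0)).
- by rewrite /tmul (tliftD (tmul_bilinear 0)) [X in X + _]hx [X in _ + X]hy addr0.
- by rewrite /tmul (tliftE (tmul_bilinear 0)) tmap_mul0.
Qed.

Let tmul0l x : tmul 0 x = 0.
Proof. exact: (tlift0 (tmul_bilinear x)). Qed.

Let tmulDl : left_distributive tmul +%R.
Proof. by move=> x y z; exact: (tliftD (tmul_bilinear z)). Qed.

Let tmulDr : right_distributive tmul +%R.
Proof.
move=> x y z; elim/tensor_ind: x => [|x x' hx hx'|a b].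
- by rewrite !tmul0l addr0.
- by rewrite !tmulDl hx hx' addrACA.
- by rewrite /tmul !(tliftE (tmul_bilinear _)) tmap_mulD.
Qed.

Let tmulA : associative tmul.
Proof.
move=> x y z; elim/tensor_ind: x => [|x x' hx hx'|a b].
- by rewrite !tmul0l.
- by rewrite !tmulDl hx hx'.
elim/tensor_ind: y => [|y y' hy hy'|a' b'].
- by rewrite !(tmul0l, tmul0r).
- by rewrite !(tmulDl, tmulDr) hy hy'.
elim/tensor_ind: z => [|z z' hz hz'|a'' b''].
- by rewrite !tmul0r.
- by rewrite !tmulDr hz hz'.
by rewrite !tmulE !mulrA.
Qed.

Let tmul1l : left_id (1 \ot 1) tmul.
Proof.
elim/tensor_ind => [|y y' hy hy'|a b]; first by rewrite tmul0r.
  by rewrite tmulDr hy hy'.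
by rewrite tmulE !mul1r.
Qed.

Let tmul1r : right_id (1 \ot 1) tmul.
Proof.
elim/tensor_ind => [|y y' hy hy'|a b]; first by rewrite tmul0l.
  by rewrite tmulDl hy hy'.
by rewrite tmulE !mulr1.
Qed.

Let tone_neq0 : 1 \ot 1 != 0 :> AB.
Proof.
have [f fl f1] := @ex_linear_form k A 1 (oner_neq0 A).
have [g gl g1] := @ex_linear_form k B 1 (oner_neq0 B).
have fD : {morph f : x y / x + y}.
  by move=> x y; rewrite -[x]scale1r fl mul1r scale1r.
have gD : {morph g : x y / x + y}.
  by move=> x y; rewrite -[x]scale1r gl mul1r scale1r.
have f0 : f 0 = 0 by apply: (addrI (f 0)); rewrite -fD !addr0.
have g0 : g 0 = 0 by apply: (addrI (g 0)); rewrite -gD !addr0.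
have fZ c x : f (c *: x) = c * f x by rewrite -[c *: x]addr0 fl f0 addr0.
have gZ c x : g (c *: x) = c * g x by rewrite -[c *: x]addr0 gl g0 addr0.
have fgB : bilinear_over (fun (a : A) (b : B) => f a * g b).
  split=> [b x y|a x y|c a b] /=; rewrite ?(fD, gD, mulrDl, mulrDr) //.
  by rewrite fZ gZ mulrCA mulrA.
apply/eqP => h; have := tliftE fgB 1 1.
by rewrite h (tlift0 fgB) f1 g1 mulr1 => /esym/eqP; rewrite oner_eq0.
Qed.

HB.instance Definition _ := GRing.Zmodule_isNzRing.Build (tensor A B)
  tmulA tmul1l tmul1r tmulDl tmulDr tone_neq0.

Lemma tens1 : 1 \ot 1 = 1 :> AB. Proof. by []. Qed.

Lemma tensM (a a' : A) (b b' : B) :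
  (a \ot b) * (a' \ot b') = (a * a') \ot (b * b') :> AB.
Proof. exact: tmulE. Qed.

Let tscaleAl (c : k) (x y : AB) : c *: (x * y) = c *: x * y.
Proof.
elim/tensor_ind: x => [|x x' hx hx'|a b].
- by rewrite !(scaler0, mul0r).
- by rewrite !(mulrDl, scalerDr) hx hx'.
elim/tensor_ind: y => [|y y' hy hy'|a' b'].
- by rewrite !(scaler0, mulr0).
- by rewrite !(mulrDr, scalerDr) hy hy'.
by rewrite tensM -!tensZl tensM scalerAl.
Qed.

HB.instance Definition _ :=
  GRing.Lmodule_isLalgebra.Build k (tensor A B) tscaleAl.

Let tscaleAr (c : k) (x y : AB) : c *: (x * y) = x * (c *: y).
Proof.
elim/tensor_ind: x => [|x x' hx hx'|a b].
- by rewrite !(scaler0, mul0r).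
- by rewrite !(mulrDl, scalerDr) hx hx'.
elim/tensor_ind: y => [|y y' hy hy'|a' b'].
- by rewrite !(scaler0, mulr0).
- by rewrite !(mulrDr, scalerDr) hy hy'.
by rewrite tensM -!tensZl tensM scalerAr.
Qed.

HB.instance Definition _ :=
  GRing.Lalgebra_isAlgebra.Build k (tensor A B) tscaleAr.

End TensorAlgebra.

Section TensorFunctor.
Variable k : comPzRingType.
Implicit Types U V W : lmodType k.

Lemma raddf_tlift U V (W W' : zmodType) (phi : {additive W -> W'})
    (f : U -> V -> W) t :
  phi (tlift f t) = tlift (fun u v => phi (f u v)) t.
Proof. exact: raddf_sum. Qed.

Lemma eq_tlift U V (W : zmodType) (f g : U -> V -> W) t :
  (forall u v, f u v = g u v) -> tlift f t = tlift g t.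
Proof. by move=> fg; apply: eq_bigr => p _; rewrite fg. Qed.

Lemma eq_tmap U V U' V' (f f' : U -> U') (g g' : V -> V') t :
  f =1 f' -> g =1 g' -> tmap f g t = tmap f' g' t.
Proof. by move=> ff gg; apply: eq_tlift => u v; rewrite ff gg. Qed.

Lemma tlift_tmap U V U' V' (W : zmodType) (F : U' -> V' -> W)
    (f : U -> U') (g : V -> V') t : bilinear_over F ->
  tlift F (tmap f g t) = tlift (fun u v => F (f u) (g v)) t.
Proof.
move=> FB; rewrite /tmap [X in tlift F X]/tlift [RHS]/tlift.
elim: (trep t) => [|p s IHs]; first by rewrite !big_nil (tlift0 FB).
by rewrite !big_cons (tliftD FB) (tliftE FB) IHs.
Qed.

Lemma tmap_comp U V U' V' U'' V'' (f' : {linear U' -> U''})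
    (g' : {linear V' -> V''}) (f : U -> U') (g : V -> V') t :
  tmap f' g' (tmap f g t) = tmap (f' \o f) (g' \o g) t.
Proof. exact/tlift_tmap/tmap_bilinear. Qed.

Lemma tassoc_nat U V W U' V' W' (f : {linear U -> U'}) (g : {linear V -> V'})
    (h : {linear W -> W'}) t :
  tassoc (tmap (tmap f g) h t) = tmap f (tmap g h) (tassoc t).
Proof.
elim/tensor_ind: t => [|x y hx hy|x w]; first by rewrite !linear0.
  by rewrite !linearD /= hx hy.
elim/tensor_ind: x => [|x y hx hy|u v].
- have -> : (0 : U \ot V) \ot w = 0 by rewrite -(scale0r 0) tensZl scale0r.
  by rewrite !linear0.
- by rewrite tensDl !linearD /= hx hy.
- by rewrite tassocE !tmapE /= !tmapE tassocE.
Qed.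

End TensorFunctor.

Lemma tmap_monoid (k : fieldType) (A B A' B' : algType k)
    (f : {lrmorphism A -> A'}) (g : {lrmorphism B -> B'}) :
  monoid_morphism (tmap f g).
Proof.
split=> [|x y]; first by rewrite tmapE !rmorph1.
elim/tensor_ind: x => [|x x' hx hx'|a b].
- by rewrite !(mul0r, linear0).
- by rewrite !(mulrDl, linearD) /= hx hx'.
elim/tensor_ind: y => [|y y' hy hy'|a' b'].
- by rewrite !(mulr0, linear0).
- by rewrite !(mulrDr, linearD) /= hy hy'.
by rewrite tensM !tmapE tensM !rmorphM.
Qed.

HB.instance Definition _ (k : fieldType) (A B A' B' : algType k)
    (f : {lrmorphism A -> A'}) (g : {lrmorphism B -> B'}) :=
  GRing.isMonoidMorphism.Build (tensor A B) (tensor A' B') (tmap f g)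
    (tmap_monoid f g).

HB.mixin Record isQuasiHopf (k : fieldType) H of GRing.Algebra k H := {
  Delta : {lrmorphism H -> H \ot H};
  counit : {lrmorphism H -> k^o};
  Phi : H \ot (H \ot H);
  Phi_inv : H \ot (H \ot H);
  antipode : {linear H -> H};
  alpha : H;
  beta : H;
  Phi_mulV : Phi * Phi_inv = 1;
  Phi_mulVl : Phi_inv * Phi = 1;
  antipode1 : antipode 1 = 1;
  antipodeM : forall x y, antipode (x * y) = antipode y * antipode x;
  (* all tensor powers are associated to the right *)
  Phi_pentagon :
    (1 \ot Phi) * tmap idfun (tassoc \o tmap Delta idfun) Phi
      * tmap idfun tassoc (tassoc (Phi \ot 1))
    = tmap idfun (tmap idfun Delta) Phi * tassoc (tmap Delta idfun Phi);
  quasi_coassoc : forall x,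
    Phi * tassoc (tmap Delta idfun (Delta x)) = tmap idfun Delta (Delta x) * Phi;
  Phi_counit :
    tmap idfun (tlift (fun a b => (counit a : k) *: b)) Phi = 1 \ot 1;
  counit_right : forall x, tlift (fun a b => (counit b : k) *: a) (Delta x) = x;
  counit_left : forall x, tlift (fun a b => (counit a : k) *: b) (Delta x) = x;
  antipode_alpha : forall x,
    tlift (fun a b => antipode a * alpha * b) (Delta x)
    = (counit x : k) *: alpha;
  antipode_beta : forall x,
    tlift (fun a b => a * beta * antipode b) (Delta x)
    = (counit x : k) *: beta;
  Phi_antipode :
    tlift (fun a => tlift (fun b c => a * beta * antipode b * alpha * c)) Phi
    = 1;
  Phi_inv_antipode :
    tlift (fun a =>
      tlift (fun b c => antipode a * alpha * b * beta * antipode c)) Phi_inv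
    = 1;
  counit_alpha : counit alpha = 1;
  counit_beta : counit beta = 1
}.

#[short(type="quasiHopfType")]
HB.structure Definition QuasiHopf (k : fieldType) :=
  {H of isQuasiHopf k H & GRing.Algebra k H}.

Section Subspaces.
Variables (k : fieldType).

Definition subspace (V : lmodType k) (X : set V) : Prop :=
  X 0 /\ forall c x y, X x -> X y -> X (c *: x + y).

Definition linspan (V : lmodType k) (X : set V) : set V :=
  [set v | exists2 s : seq (k * V),
     forall p, p \in s -> X p.2 & v = \sum_(p <- s) p.1 *: p.2].

Definition sumset (V : lmodType k) (X Y : set V) : set V := linspan (X `|` Y).

Definition prodset (A : algType k) (X Y : set A) : set A :=
  linspan [set x * y | x in X & y in Y].

(* the image of X \ot Y in U \ot V *)
Definition tensset (U V : lmodType k) (X : set U) (Y : set V) : set (U \ot V) :=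
  linspan [set x \ot y | x in X & y in Y].

Definition ideal_gen (A : algType k) (X : set A) : set A :=
  linspan [set y | exists a x b, X x /\ y = a * x * b].

Lemma linspan_subspace (V : lmodType k) (X : set V) : subspace (linspan X).
Proof.
split; first by exists [::] => //; rewrite big_nil.
move=> c _ _ [s sX ->] [t tX ->].
exists ([seq (c * p.1, p.2) | p <- s] ++ t).
  by move=> p; rewrite mem_cat => /orP[/mapP [r /sX Xr ->]|/tX].
rewrite big_cat big_map /= scaler_sumr; congr (_ + _).
by apply: eq_bigr => p _; rewrite scalerA.
Qed.

Lemma linspan_sub (V : lmodType k) (X Y : set V) :
  subspace Y -> X `<=` Y -> linspan X `<=` Y.
Proof.
move=> [Y0 Yl] XY _ [s sX ->].
elim: s sX => [|p s IHs] sX; first by rewrite big_nil.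
rewrite big_cons; apply: Yl; first by apply/XY/sX; rewrite inE eqxx.
by apply: IHs => r rs; apply: sX; rewrite inE rs orbT.
Qed.

Lemma linspan_in (V : lmodType k) (X : set V) : X `<=` linspan X.
Proof.
move=> x Xx; exists [:: (1, x)]; last by rewrite big_seq1 scale1r.
by move=> p; rewrite inE => /eqP ->.
Qed.

Lemma subspace_preim (V W : lmodType k) (f : {linear V -> W}) (Y : set W) :
  subspace Y -> subspace [set x | Y (f x)].
Proof.
move=> [Y0 Yl]; split=> /= [|c x y]; first by rewrite linear0.
by rewrite linearP; apply: Yl.
Qed.

Lemma subspaceD (V : lmodType k) (X : set V) x y :
  subspace X -> X x -> X y -> X (x + y).
Proof. by move=> [_ Xl] Xx; rewrite -[x]scale1r; apply: Xl. Qed.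

Lemma linspan0 (V W : lmodType k) (f : {linear V -> W}) (X : set V) x :
  (forall y, X y -> f y = 0) -> linspan X x -> f x = 0.
Proof.
move=> fX [s sX ->]; rewrite linear_sum big_seq big1 // => p /sX /fX h.
by rewrite linearZ /= h scaler0.
Qed.

End Subspaces.

(* I is a quasi-Hopf ideal of the quasi-Hopf subalgebra A of H *)
Record is_qhideal (k : fieldType) (H : quasiHopfType k) (A I : set H) : Prop :=
  IsQHIdeal {
    qhi_sub : I `<=` A;
    qhi_subspace : subspace I;
    qhi_mull : forall a x, A a -> I x -> I (a * x);
    qhi_mulr : forall a x, A a -> I x -> I (x * a);
    qhi_Delta : forall x, I x -> sumset (tensset I A) (tensset A I) (Delta x);
    qhi_counit : forall x, I x -> counit x = 0;
    qhi_antipode : forall x, I x -> I (antipode x)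
  }.

Record qhIdeal (k : fieldType) (H : quasiHopfType k) := QHIdeal {
  qhideal_set :> set H;
  qhidealP : is_qhideal setT qhideal_set
}.

Section StructureMapsBilinear.
Variable k : fieldType.

Lemma counitl_bilinear (A : lmodType k) (e : {linear A -> k^o}) :
  bilinear_over (fun (a : A) (b : A) => (e a : k) *: b).
Proof.
split=> [b x y|a x y|c a b] /=.
- by rewrite linearD scalerDl.
- by rewrite scalerDr.
- by rewrite [e (_ *: _)]linearZ [RHS]scalerA mulrC.
Qed.

Lemma counitr_bilinear (A : lmodType k) (e : {linear A -> k^o}) :
  bilinear_over (fun (a : A) (b : A) => (e b : k) *: a).
Proof.
split=> [b x y|a x y|c a b] /=.
- by rewrite scalerDr.
- by rewrite linearD scalerDl.
- by rewrite [e (_ *: _)]linearZ [LHS]scalerA mulrC.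
Qed.

Variables (A : algType k) (s : {linear A -> A}) (x y : A).

Lemma antipodel_bilinear : bilinear_over (fun a b => s a * x * b).
Proof.
split=> [b a a'|a b b'|c a b] /=.
- by rewrite linearD !mulrDl.
- by rewrite mulrDr.
- by rewrite linearZ /= -!scalerAl scalerAr.
Qed.

Lemma antipoder_bilinear : bilinear_over (fun a b => a * x * s b).
Proof.
split=> [b a a'|a b b'|c a b] /=.
- by rewrite !mulrDl.
- by rewrite linearD mulrDr.
- by rewrite linearZ /= -!scalerAl scalerAr.
Qed.

Lemma antipodem_bilinear0 a : bilinear_over (fun b c => a * x * s b * y * c).
Proof.
split=> [c b b'|b c c'|d b c] /=.
- by rewrite linearD mulrDr !mulrDl.
- by rewrite mulrDr.
- by rewrite linearZ /= -!scalerAr -!scalerAl.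
Qed.

Lemma antipodeo_bilinear0 a :
  bilinear_over (fun b c => s a * x * b * y * s c).
Proof.
split=> [c b b'|b c c'|d b c] /=.
- by rewrite mulrDr !mulrDl.
- by rewrite linearD mulrDr.
- by rewrite linearZ /= -!scalerAr -!scalerAl.
Qed.

Lemma antipodem_bilinear :
  bilinear_over (fun a => tlift (fun b c => a * x * s b * y * c)).
Proof.
have B := antipodem_bilinear0.
split=> [t a a'|a t t'|d a t] /=; last 1 first.
- elim/tensor_ind: t => [|t t' ht ht'|b c].
  + by rewrite scaler0 !(tlift0 (B _)).
  + by rewrite scalerDr !(tliftD (B _)) ht ht'.
  + by rewrite -tensZl !(tliftE (B _)) linearZ /= -!(scalerAl, scalerAr).
- elim/tensor_ind: t => [|t t' ht ht'|b c].
  + by rewrite !(tlift0 (B _)) addr0.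
  + by rewrite !(tliftD (B _)) ht ht' addrACA.
  + by rewrite !(tliftE (B _)) !mulrDl.
- by rewrite (tliftD (B _)).
Qed.

Lemma antipodeo_bilinear :
  bilinear_over (fun a => tlift (fun b c => s a * x * b * y * s c)).
Proof.
have B := antipodeo_bilinear0.
split=> [t a a'|a t t'|d a t] /=; last 1 first.
- elim/tensor_ind: t => [|t t' ht ht'|b c].
  + by rewrite scaler0 !(tlift0 (B _)).
  + by rewrite scalerDr !(tliftD (B _)) ht ht'.
  + by rewrite -tensZl !(tliftE (B _)) linearZ /= -!(scalerAl, scalerAr).
- elim/tensor_ind: t => [|t t' ht ht'|b c].
  + by rewrite !(tlift0 (B _)) addr0.
  + by rewrite !(tliftD (B _)) ht ht' addrACA.
  + by rewrite !(tliftE (B _)) linearD !mulrDl.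
- by rewrite (tliftD (B _)).
Qed.

End StructureMapsBilinear.

Section Quotient.
Variables (k : fieldType) (H : quasiHopfType k) (I : qhIdeal H).

Definition qhideal_pred (x : H) : bool := `[< qhideal_set I x >].

Lemma qhideal_pred_zmod : zmod_closed qhideal_pred.
Proof.
have [_ [I0 Il] _ _ _ _ _] := qhidealP I.
split=> [|x y /asboolP hx /asboolP hy]; apply/asboolP => //.
by rewrite addrC -scaleN1r; apply: Il.
Qed.

HB.instance Definition _ := GRing.isZmodClosed.Build H qhideal_pred
  qhideal_pred_zmod.

Definition qhideal_zmod := GRing.ZmodClosed.clone H qhideal_pred _.

Definition qhquot : Type := Quotient.quot qhideal_zmod.
HB.instance Definition _ := GRing.Zmodule.on qhquot.

Definition qhproj (x : H) : qhquot := \pi_(Quotient.quot qhideal_zmod) x.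
Definition qhrepr (x : qhquot) : H := repr (x : Quotient.quot qhideal_zmod).

Lemma qhreprK x : qhproj (qhrepr x) = x.
Proof. exact: reprK. Qed.

Lemma qhprojP x y : qhproj x = qhproj y <-> qhideal_set I (x - y).
Proof.
rewrite /qhproj; split=> [/eqP|h].
  by rewrite -Quotient.idealrBE => /asboolP.
by apply/eqP; rewrite -Quotient.idealrBE; apply/asboolP.
Qed.

Lemma qhprojD : {morph qhproj : x y / x + y}.
Proof. by move=> x y; rewrite /qhproj !piE. Qed.

Lemma qhproj_eq0 x : qhproj x = 0 <-> qhideal_set I x.
Proof.
have -> : 0 = qhproj 0 by rewrite /qhproj !piE.
by rewrite qhprojP subr0.
Qed.

Definition qhscale (c : k) (x : qhquot) : qhquot := qhproj (c *: qhrepr x).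
Definition qhone : qhquot := qhproj 1.
Definition qhmul (x y : qhquot) : qhquot := qhproj (qhrepr x * qhrepr y).

Lemma qhscaleE c x : qhscale c (qhproj x) = qhproj (c *: x).
Proof.
apply/qhprojP; rewrite -scalerBr.
have [_ [I0 Il] _ _ _ _ _] := qhidealP I.
by rewrite -[_ *: _]addr0; apply: Il => //; apply/qhprojP; rewrite qhreprK.
Qed.

Lemma qhmulE x y : qhmul (qhproj x) (qhproj y) = qhproj (x * y).
Proof.
apply/qhprojP; have [_ [I0 Il] hl hr _ _ _] := qhidealP I.
set x' := qhrepr _; set y' := qhrepr _.
have -> : x' * y' - x * y = 1 *: ((x' - x) * y') + x * (y' - y).
  by rewrite scale1r mulrBl mulrBr addrA subrK.
apply: Il; first by apply: hr => //; apply/qhprojP; rewrite qhreprK.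
by apply: hl => //; apply/qhprojP; rewrite qhreprK.
Qed.

Lemma qhprojW (P : qhquot -> Prop) : (forall x, P (qhproj x)) -> forall x, P x.
Proof. by move=> h x; rewrite -[x]qhreprK. Qed.

Lemma qhscaleA a b x : qhscale a (qhscale b x) = qhscale (a * b) x.
Proof. by elim/qhprojW: x => x; rewrite !qhscaleE scalerA. Qed.

Lemma qhscale1 : left_id 1 qhscale.
Proof. by elim/qhprojW => x; rewrite qhscaleE scale1r. Qed.

Lemma qhscaleDr : right_distributive qhscale +%R.
Proof.
move=> c; elim/qhprojW => x; elim/qhprojW => y.
by rewrite -qhprojD !qhscaleE scalerDr qhprojD.
Qed.

Lemma qhscaleDl x : {morph qhscale^~ x : a b / a + b}.
Proof. by move=> a b; elim/qhprojW: x => x; rewrite !qhscaleE scalerDl qhprojD. Qed.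

HB.instance Definition _ := GRing.Zmodule_isLmodule.Build k qhquot
  qhscaleA qhscale1 qhscaleDr qhscaleDl.

Lemma qhmulA : associative qhmul.
Proof.
elim/qhprojW => x; elim/qhprojW => y; elim/qhprojW => z.
by rewrite !qhmulE mulrA.
Qed.

Lemma qhmul1l : left_id qhone qhmul.
Proof. by elim/qhprojW => x; rewrite qhmulE mul1r. Qed.

Lemma qhmul1r : right_id qhone qhmul.
Proof. by elim/qhprojW => x; rewrite qhmulE mulr1. Qed.

Lemma qhmulDl : left_distributive qhmul +%R.
Proof.
elim/qhprojW => x; elim/qhprojW => y; elim/qhprojW => z.
by rewrite -qhprojD !qhmulE mulrDl qhprojD.
Qed.

Lemma qhmulDr : right_distributive qhmul +%R.
Proof.
elim/qhprojW => x; elim/qhprojW => y; elim/qhprojW => z.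
by rewrite -qhprojD !qhmulE mulrDr qhprojD.
Qed.

Lemma qhone_neq0 : qhone != 0.
Proof.
apply/eqP => /qhproj_eq0 /(qhi_counit (qhidealP I)) /eqP.
by rewrite rmorph1 oner_eq0.
Qed.

HB.instance Definition _ := GRing.Zmodule_isNzRing.Build qhquot
  qhmulA qhmul1l qhmul1r qhmulDl qhmulDr qhone_neq0.

Lemma qhprojZ c x : qhproj (c *: x) = c *: qhproj x.
Proof. by rewrite -qhscaleE. Qed.

Lemma qhprojM : {morph qhproj : x y / x * y}.
Proof. by move=> x y; rewrite -qhmulE. Qed.

Lemma qhscaleAl (c : k) (x y : qhquot) : c *: (x * y) = c *: x * y.
Proof.
elim/qhprojW: x => x; elim/qhprojW: y => y.
by rewrite -qhprojM -!qhprojZ -qhprojM scalerAl.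
Qed.

HB.instance Definition _ := GRing.Lmodule_isLalgebra.Build k qhquot qhscaleAl.

Lemma qhscaleAr (c : k) (x y : qhquot) : c *: (x * y) = x * (c *: y).
Proof.
elim/qhprojW: x => x; elim/qhprojW: y => y.
by rewrite -qhprojM -!qhprojZ -qhprojM scalerAr.
Qed.

HB.instance Definition _ := GRing.Lalgebra_isAlgebra.Build k qhquot qhscaleAr.

Lemma qhproj_linear : linear qhproj.
Proof. by move=> c x y; rewrite qhprojD qhprojZ. Qed.

HB.instance Definition _ := GRing.isLinear.Build k H qhquot _ qhproj
  qhproj_linear.

Lemma qhproj_monoid : monoid_morphism qhproj.
Proof. by split=> //; exact: qhprojM. Qed.

HB.instance Definition _ := GRing.isMonoidMorphism.Build H qhquot qhproj
  qhproj_monoid.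

Lemma qhquot_Delta_eq0 x : qhideal_set I x -> tmap qhproj qhproj (Delta x) = 0.
Proof.
move=> /(qhi_Delta (qhidealP I)); apply: linspan0 => y [|].
  apply: linspan0 => _ [a Ia [b _ <-]]; rewrite /= tmapE /=.
  by move/qhproj_eq0: Ia => ->; rewrite -(scale0r 0) tensZl scale0r.
apply: linspan0 => _ [a _ [b Ib <-]]; rewrite /= tmapE /=.
by move/qhproj_eq0: Ib => ->; rewrite -(scale0r 0) tensZr scale0r.
Qed.

Definition qhquot_Delta (x : qhquot) : qhquot \ot qhquot :=
  tmap qhproj qhproj (Delta (qhrepr x)).
Definition qhquot_counit (x : qhquot) : k^o := counit (qhrepr x).
Definition qhquot_antipode (x : qhquot) : qhquot := qhproj (antipode (qhrepr x)).

Lemma qhquot_DeltaE x :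
  qhquot_Delta (qhproj x) = tmap qhproj qhproj (Delta x).
Proof.
apply/eqP; rewrite -subr_eq0 -!linearB; apply/eqP.
by apply: qhquot_Delta_eq0; apply/qhprojP; rewrite qhreprK.
Qed.

Lemma qhquot_counitE x : qhquot_counit (qhproj x) = counit x.
Proof.
apply/eqP; rewrite -subr_eq0 -linearB; apply/eqP.
by apply: (qhi_counit (qhidealP I)); apply/qhprojP; rewrite qhreprK.
Qed.

Lemma qhquot_antipodeE x : qhquot_antipode (qhproj x) = qhproj (antipode x).
Proof.
apply/qhprojP; rewrite -linearB.
by apply: (qhi_antipode (qhidealP I)); apply/qhprojP; rewrite qhreprK.
Qed.


Local Notation q := qhproj.
Local Notation q2 := (tmap qhproj qhproj).
Local Notation q3 := (tmap qhproj (tmap qhproj qhproj)).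
Local Notation q4 := (tmap qhproj (tmap qhproj (tmap qhproj qhproj))).

Lemma qhquot_Delta_linear : linear qhquot_Delta.
Proof.
move=> c; elim/qhprojW => x; elim/qhprojW => y.
by rewrite -linearP !qhquot_DeltaE !linearP.
Qed.

HB.instance Definition _ :=
  GRing.isLinear.Build k qhquot (tensor qhquot qhquot) _ qhquot_Delta
    qhquot_Delta_linear.

Lemma qhquot_Delta_monoid : monoid_morphism qhquot_Delta.
Proof.
split=> [|x y]; first by rewrite -[1]/(q 1) qhquot_DeltaE !rmorph1.
elim/qhprojW: x => x; elim/qhprojW: y => y.
by rewrite -rmorphM !qhquot_DeltaE !rmorphM.
Qed.

HB.instance Definition _ :=
  GRing.isMonoidMorphism.Build qhquot (tensor qhquot qhquot) qhquot_Delta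
    qhquot_Delta_monoid.

Lemma qhquot_counit_linear : linear qhquot_counit.
Proof.
move=> c; elim/qhprojW => x; elim/qhprojW => y.
by rewrite -linearP !qhquot_counitE !linearP.
Qed.

HB.instance Definition _ :=
  GRing.isLinear.Build k qhquot k^o _ qhquot_counit qhquot_counit_linear.

Lemma qhquot_counit_monoid : monoid_morphism qhquot_counit.
Proof.
split=> [|x y]; first by rewrite -[1]/(q 1) qhquot_counitE !rmorph1.
elim/qhprojW: x => x; elim/qhprojW: y => y.
by rewrite -rmorphM !qhquot_counitE !rmorphM.
Qed.

HB.instance Definition _ :=
  GRing.isMonoidMorphism.Build qhquot k^o qhquot_counit qhquot_counit_monoid.

Lemma qhquot_antipode_linear : linear qhquot_antipode.
Proof.
move=> c; elim/qhprojW => x; elim/qhprojW => y.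
by rewrite -linearP !qhquot_antipodeE !linearP.
Qed.

HB.instance Definition _ :=
  GRing.isLinear.Build k qhquot qhquot _ qhquot_antipode qhquot_antipode_linear.

Lemma qhquot_Phi_mulV : q3 Phi * q3 Phi_inv = 1.
Proof. by rewrite -rmorphM Phi_mulV rmorph1. Qed.

Lemma qhquot_Phi_mulVl : q3 Phi_inv * q3 Phi = 1.
Proof. by rewrite -rmorphM Phi_mulVl rmorph1. Qed.

Lemma qhquot_antipode1 : qhquot_antipode 1 = 1.
Proof. by rewrite -[1]/(q 1) qhquot_antipodeE antipode1. Qed.

Lemma qhquot_antipodeM x y :
  qhquot_antipode (x * y) = qhquot_antipode y * qhquot_antipode x.
Proof.
elim/qhprojW: x => x; elim/qhprojW: y => y.
by rewrite -rmorphM !qhquot_antipodeE antipodeM rmorphM.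
Qed.

Lemma qhquot_DeltaL t :
  tassoc (tmap qhquot_Delta idfun (q2 t)) = q3 (tassoc (tmap Delta idfun t)).
Proof.
rewrite -tassoc_nat !tmap_comp; congr tassoc.
by apply: eq_tmap => x //=; rewrite qhquot_DeltaE.
Qed.

Lemma qhquot_DeltaR t : tmap idfun qhquot_Delta (q2 t) = q3 (tmap idfun Delta t).
Proof.
by rewrite !tmap_comp; apply: eq_tmap => x //=; rewrite qhquot_DeltaE.
Qed.

Lemma qhquot_Phi_pentagon :
  (1 \ot q3 Phi) * tmap idfun (tassoc \o tmap qhquot_Delta idfun) (q3 Phi)
    * tmap idfun tassoc (tassoc (q3 Phi \ot 1))
  = tmap idfun (tmap idfun qhquot_Delta) (q3 Phi)
    * tassoc (tmap qhquot_Delta idfun (q3 Phi)).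
Proof.
have -> : 1 \ot q3 Phi = q4 (1 \ot Phi) by rewrite [RHS]tmapE rmorph1.
have -> : tmap idfun (tassoc \o tmap qhquot_Delta idfun) (q3 Phi)
    = q4 (tmap idfun (tassoc \o tmap Delta idfun) Phi).
  by rewrite !tmap_comp; apply: eq_tmap => t //=; exact: qhquot_DeltaL.
have -> : tmap idfun tassoc (tassoc (q3 Phi \ot 1))
    = q4 (tmap idfun tassoc (tassoc (Phi \ot 1))).
  have -> : q3 Phi \ot 1 = tmap q3 q (Phi \ot 1) by rewrite tmapE rmorph1.
  rewrite tassoc_nat !tmap_comp.
  by apply: eq_tmap => t //=; exact: tassoc_nat.
have -> : tmap idfun (tmap idfun qhquot_Delta) (q3 Phi)
    = q4 (tmap idfun (tmap idfun Delta) Phi).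
  by rewrite !tmap_comp; apply: eq_tmap => t //=; exact: qhquot_DeltaR.
have -> : tassoc (tmap qhquot_Delta idfun (q3 Phi))
    = q4 (tassoc (tmap Delta idfun Phi)).
  rewrite -tassoc_nat !tmap_comp; congr tassoc.
  by apply: eq_tmap => t //=; exact: qhquot_DeltaE.
by rewrite -!rmorphM Phi_pentagon.
Qed.

Lemma qhquot_coassoc x :
  q3 Phi * tassoc (tmap qhquot_Delta idfun (qhquot_Delta x))
  = tmap idfun qhquot_Delta (qhquot_Delta x) * q3 Phi.
Proof.
elim/qhprojW: x => x; rewrite qhquot_DeltaE qhquot_DeltaL qhquot_DeltaR.
by rewrite -!rmorphM quasi_coassoc.
Qed.

Lemma qhquot_counitL t :
  tlift (fun a b : qhquot => (qhquot_counit a : k) *: b) (q2 t)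
  = q (tlift (fun a b : H => (counit a : k) *: b) t).
Proof.
rewrite tlift_tmap; last exact: (counitl_bilinear qhquot_counit).
by rewrite raddf_tlift; apply: eq_tlift => u v /=; rewrite qhquot_counitE linearZ.
Qed.

Lemma qhquot_counitR t :
  tlift (fun a b : qhquot => (qhquot_counit b : k) *: a) (q2 t)
  = q (tlift (fun a b : H => (counit b : k) *: a) t).
Proof.
rewrite tlift_tmap; last exact: (counitr_bilinear qhquot_counit).
by rewrite raddf_tlift; apply: eq_tlift => u v /=; rewrite qhquot_counitE linearZ.
Qed.

Lemma qhquot_counit_left x :
  tlift (fun a b : qhquot => (qhquot_counit a : k) *: b) (qhquot_Delta x) = x.
Proof.
by elim/qhprojW: x => x; rewrite qhquot_DeltaE qhquot_counitL counit_left.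
Qed.

Lemma qhquot_counit_right x :
  tlift (fun a b : qhquot => (qhquot_counit b : k) *: a) (qhquot_Delta x) = x.
Proof.
by elim/qhprojW: x => x; rewrite qhquot_DeltaE qhquot_counitR counit_right.
Qed.

Lemma qhquot_Phi_counit :
  tmap idfun (tlift (fun a b : qhquot => (qhquot_counit a : k) *: b)) (q3 Phi)
  = 1 \ot 1.
Proof.
rewrite [LHS]tlift_tmap /=; last first.
  have h : linear (tlift (fun a b : qhquot => (qhquot_counit a : k) *: b)).
    apply: tlift_linear; first exact: (counitl_bilinear qhquot_counit).
    by move=> c u v; rewrite linearZ [RHS]scalerA.
  pose h' := GRing.isLinear.Build k _ _ _ _ h.
  pose f : {linear (qhquot \ot qhquot)%type -> qhquot} :=
    HB.pack (tlift (fun a b : qhquot => (qhquot_counit a : k) *: b)) h'.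
  exact: (tmap_bilinear idfun f).
have <- : q2 (1 \ot 1) = 1 \ot 1 by rewrite tmapE rmorph1.
rewrite -Phi_counit raddf_tlift; apply: eq_tlift => u v /=.
by rewrite tmapE /= qhquot_counitL.
Qed.

Lemma qhquot_antipode_alpha x :
  tlift (fun a b => qhquot_antipode a * q alpha * b) (qhquot_Delta x)
  = (qhquot_counit x : k) *: q alpha.
Proof.
elim/qhprojW: x => x; rewrite qhquot_DeltaE tlift_tmap; last first.
  exact: (antipodel_bilinear qhquot_antipode).
rewrite qhquot_counitE -linearZ -antipode_alpha raddf_tlift.
by apply: eq_tlift => u v /=; rewrite qhquot_antipodeE !rmorphM.
Qed.

Lemma qhquot_antipode_beta x :
  tlift (fun a b => a * q beta * qhquot_antipode b) (qhquot_Delta x)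
  = (qhquot_counit x : k) *: q beta.
Proof.
elim/qhprojW: x => x; rewrite qhquot_DeltaE tlift_tmap; last first.
  exact: (antipoder_bilinear qhquot_antipode).
rewrite qhquot_counitE -linearZ -antipode_beta raddf_tlift.
by apply: eq_tlift => u v /=; rewrite qhquot_antipodeE !rmorphM.
Qed.

Lemma qhquot_Phi_antipode :
  tlift (fun a =>
    tlift (fun b c => a * q beta * qhquot_antipode b * q alpha * c)) (q3 Phi)
  = 1.
Proof.
rewrite tlift_tmap; last exact: (antipodem_bilinear qhquot_antipode).
rewrite -[1]/(q 1) -Phi_antipode raddf_tlift; apply: eq_tlift => a t.
rewrite tlift_tmap; last exact: (antipodem_bilinear0 qhquot_antipode).
rewrite raddf_tlift; apply: eq_tlift => u v /=.
by rewrite qhquot_antipodeE !rmorphM.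
Qed.

Lemma qhquot_Phi_inv_antipode :
  tlift (fun a =>
    tlift (fun b c => qhquot_antipode a * q alpha * b * q beta
                        * qhquot_antipode c)) (q3 Phi_inv)
  = 1.
Proof.
rewrite tlift_tmap; last exact: (antipodeo_bilinear qhquot_antipode).
rewrite -[1]/(q 1) -Phi_inv_antipode raddf_tlift; apply: eq_tlift => a t.
rewrite tlift_tmap; last exact: (antipodeo_bilinear0 qhquot_antipode).
rewrite raddf_tlift; apply: eq_tlift => u v /=.
by rewrite !qhquot_antipodeE !rmorphM.
Qed.

HB.instance Definition _ := @isQuasiHopf.Build k qhquot
  qhquot_Delta qhquot_counit (q3 Phi) (q3 Phi_inv) qhquot_antipode
  (q alpha) (q beta)
  qhquot_Phi_mulV qhquot_Phi_mulVl qhquot_antipode1 qhquot_antipodeM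
  qhquot_Phi_pentagon qhquot_coassoc qhquot_Phi_counit
  qhquot_counit_right qhquot_counit_left
  qhquot_antipode_alpha qhquot_antipode_beta
  qhquot_Phi_antipode qhquot_Phi_inv_antipode
  (etrans (qhquot_counitE alpha) counit_alpha)
  (etrans (qhquot_counitE beta) counit_beta).

End Quotient.

Section Gradings.
Variables (k : fieldType) (G : groupType).

Record is_graded (H : quasiHopfType k) (Hg : G -> set H) : Prop := IsGraded {
  graded_subspace : forall g, subspace (Hg g);
  graded_span : forall x, exists2 s : seq (G * H),
    (forall p, p \in s -> Hg p.1 p.2) & x = \sum_(p <- s) p.2;
  graded_direct : forall (s : seq G) (x : G -> H), uniq s ->
    (forall g, Hg g (x g)) -> \sum_(g <- s) x g = 0 ->
    forall g, g \in s -> x g = 0;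
  graded_mul : forall g h x y, Hg g x -> Hg h y -> Hg (g * h)%g (x * y);
  graded_Delta : forall g x, Hg g x -> tensset (Hg g) (Hg g) (Delta x);
  graded_antipode : forall g x, Hg g x -> Hg (g^-1)%g (antipode x);
  graded_Phi :
    tensset (Hg 1%g) (tensset (Hg 1%g) (Hg 1%g)) (Phi : H \ot (H \ot H));
  graded_alpha : Hg 1%g alpha;
  graded_beta : Hg 1%g beta
}.

Record gradedQuasiHopf := GradedQuasiHopf {
  gqh_car :> quasiHopfType k;
  homog : G -> set gqh_car;
  gqhP : is_graded homog
}.

Definition faithfully_graded (H : gradedQuasiHopf) : Prop :=
  forall g, exists2 x : H, homog g x & x != 0.

(* Only the vector space structure of the group algebra k[G] is needed: it is
   {malg k[G]}, with basis << g >>. The value does not depend on the chosen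
   decomposition of x into homogeneous elements, as the sum of the homogeneous
   components is direct. *)
Definition grading_map (H : gradedQuasiHopf) (x : H) : {malg k[G]} :=
  xget 0 [set f | exists2 s : seq (G * H),
    (forall p, p \in s -> homog p.1 p.2) /\ x = \sum_(p <- s) p.2
    & f = \sum_(p <- s) << (counit p.2 : k) *g p.1 >>].

(* the subgroup N_I of a quasi-Hopf ideal I *)
Definition ideal_support (H : gradedQuasiHopf) (I : set H) : set G :=
  [set g | exists2 x, I x & grading_map x = << g >> - << 1%g >>].

Record normalSubgroup := NormalSubgroup {
  nsg_pred :> {pred G};
  nsg_closed : group_closed nsg_pred;
  nsg_normal : forall g n, n \in nsg_pred -> (g * n * g^-1)%g \in nsg_pred
}.

End Gradings.

Section NormalSubgroupType.
Variables (G : groupType) (N : normalSubgroup G).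

Definition nsg_sort : Type := {x : G | x \in nsg_pred N}.
HB.instance Definition _ := SubChoice.on nsg_sort.
HB.instance Definition _ :=
  SubChoice_isSubGroup.Build G (nsg_pred N) nsg_sort (nsg_closed N).

Definition nsg_conj (g : G) (n : nsg_sort) : nsg_sort :=
  Sub (g * val n * g^-1)%g (nsg_normal g (valP n)).

End NormalSubgroupType.

Coercion nsg_sort : normalSubgroup >-> Sortclass.

Section LiftedQuotient.
Variables (k : fieldType) (G : groupType) (H : gradedQuasiHopf k G).

(* G-invariant quasi-Hopf ideals of H_e *)
Record invIdeal := InvIdeal {
  inv_set :> set H;
  inv_qhideal : is_qhideal (homog 1%g) inv_set;
  inv_inv : forall g, prodset (homog g) inv_set = prodset inv_set (homog g)
}.

(* J^G = HJ *)
Definition lift_set (J : invIdeal) : set H := prodset setT J.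

Lemma lift_set_qhideal (J : invIdeal) : is_qhideal setT (lift_set J).
Proof.
have JG : subspace (lift_set J) by exact: linspan_subspace.
have [J1 [J0 Jl] _ _ JD Je JS] := inv_qhideal J.
have lmulP (C : algType k) (a : C) (Y : set C) :
    subspace Y -> subspace [set x | Y (a * x)].
  move=> [Y0 Yl]; split=> /= [|c x y]; first by rewrite mulr0.
  by move=> hx hy; rewrite mulrDr -scalerAr; apply: Yl.
have rmulP (C : algType k) (a : C) (Y : set C) :
    subspace Y -> subspace [set x | Y (x * a)].
  move=> [Y0 Yl]; split=> /= [|c x y]; first by rewrite mul0r.
  by move=> hx hy; rewrite mulrDl -scalerAl; apply: Yl.
have JGl (a x : H) : lift_set J x -> lift_set J (a * x).
  apply: (linspan_sub (lmulP _ a _ JG)) => _ [h _ [j Jj <-]] /=.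
  by rewrite mulrA; apply: linspan_in; exists (a * h) => //; exists j.
have JH (j b : H) : inv_set J j -> lift_set J (j * b).
  move=> Jj; have [s sH ->] := graded_span (gqhP H) b.
  elim: s sH => [|[g y] s IHs] sH; first by rewrite big_nil mulr0; case: JG.
  rewrite big_cons mulrDr; apply: subspaceD => //; last first.
    by apply: IHs => p ps; apply: sH; rewrite inE ps orbT.
  have : prodset J (homog g) (j * y).
    apply: linspan_in; exists j => //; exists y => //.
    by apply: (sH (g, y)); rewrite inE eqxx.
  rewrite -inv_inv; apply: linspan_sub => // _ [h _ [j' Jj' <-]].
  by apply: linspan_in; exists h => //; exists j'.
have JGr (a x : H) : lift_set J x -> lift_set J (x * a).
  apply: (linspan_sub (rmulP _ a _ JG)) => _ [h _ [j Jj <-]] /=.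
  by rewrite -mulrA; apply/JGl/JH.
split=> //.
- by move=> a x _; apply: JGl.
- by move=> a x _; apply: JGr.
- set Y := sumset _ _ => x.
  have YS : subspace Y by exact: linspan_subspace.
  have YD := subspace_preim (Delta : {linear H -> (H \ot H)%type}) YS.
  move=> xJ; apply: (linspan_sub YD _ xJ) => _ [h _ [j Jj <-]] /=; rewrite rmorphM.
  have JD' := JD _ Jj.
  apply: (linspan_sub (lmulP _ (Delta h) _ YS)) JD' => t [] /=.
    apply: (linspan_sub (lmulP _ (Delta h) _ YS)) => _ [a Ja [b _ <-]] /=.
    elim/tensor_ind: (Delta h) => [|u v hu hv|u v].
    + by rewrite mul0r; case: YS.
    + by rewrite mulrDl; apply: subspaceD.
    rewrite tensM; apply: linspan_in; left; apply: linspan_in.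
    exists (u * a); first by apply: linspan_in; exists u => //; exists a.
    by exists (v * b).
  apply: (linspan_sub (lmulP _ (Delta h) _ YS)) => _ [a _ [b Jb <-]] /=.
  elim/tensor_ind: (Delta h) => [|u v hu hv|u v].
  + by rewrite mul0r; case: YS.
  + by rewrite mulrDl; apply: subspaceD.
  rewrite tensM; apply: linspan_in; right; apply: linspan_in.
  exists (u * a) => //; exists (v * b) => //.
  by apply: linspan_in; exists v => //; exists b.
- move=> x; apply: linspan0 => _ [h _ [j Jj <-]].
  by rewrite rmorphM /= (Je _ Jj) mulr0.
- move=> x; apply: (linspan_sub (subspace_preim antipode JG)).
  by move=> _ [h _ [j Jj <-]] /=; rewrite antipodeM; apply/JH/JS.
Qed.

Definition lift_ideal (J : invIdeal) : qhIdeal H :=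
  QHIdeal (lift_set_qhideal J).

Definition lifted_quot (J : invIdeal) : quasiHopfType k :=
  qhquot (lift_ideal J).

Definition lifted_proj (J : invIdeal) : H -> lifted_quot J :=
  @qhproj k H (lift_ideal J).

End LiftedQuotient.

Definition grouplike (k : fieldType) (H : quasiHopfType k) (x : H) : Prop :=
  Delta x = x \ot x /\ counit x = 1.

(* tau : A -> B is a morphism of quasi-Hopf algebras between the quasi-Hopf
   subalgebras A of Q and B of R; the values of tau outside A are irrelevant.
   As A \ot A embeds in Q \ot Q, compatibility with Delta may be tested on any
   expression of Delta x in A \ot A, and likewise for Phi. *)
Record is_qhmorphism (k : fieldType) (Q R : quasiHopfType k)
    (A : set Q) (B : set R) (tau : Q -> R) : Prop := IsQHMorphism {
  qhm_to : forall x, A x -> B (tau x);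
  qhm_linear : forall c x y, A x -> A y -> tau (c *: x + y) = c *: tau x + tau y;
  qhm1 : tau 1 = 1;
  qhmM : forall x y, A x -> A y -> tau (x * y) = tau x * tau y;
  qhm_Delta : forall x, A x -> exists s : seq (Q * Q),
    [/\ forall p, p \in s -> A p.1 /\ A p.2,
        Delta x = \sum_(p <- s) p.1 \ot p.2
      & Delta (tau x) = \sum_(p <- s) tau p.1 \ot tau p.2];
  qhm_counit : forall x, A x -> counit (tau x) = counit x;
  qhm_Phi : exists s : seq (Q * Q * Q),
    [/\ forall p, p \in s -> [/\ A p.1.1, A p.1.2 & A p.2],
        Phi = \sum_(p <- s) p.1.1 \ot (p.1.2 \ot p.2)
      & Phi = \sum_(p <- s) tau p.1.1 \ot (tau p.1.2 \ot tau p.2)];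
  qhm_antipode : forall x, A x -> tau (antipode x) = antipode (tau x);
  qhm_alpha : tau alpha = alpha;
  qhm_beta : tau beta = beta
}.

Section CharacterData.
Variables (k : fieldType) (G : groupType) (H : gradedQuasiHopf k G).
Variables (N : normalSubgroup G) (J : invIdeal H).

Local Notation Q := (lifted_quot J).
Local Notation q := (lifted_proj J).

Definition homog_sub : set H :=
  linspan [set x | exists n : N, homog (val n) x].

Definition quot_homog (g : G) : set Q := q @` homog g.

(* H_N / J^N and H_e / J, identified with q(H_N) and q(H_e) *)
Definition quot_sub : set Q := q @` homog_sub.
Definition quot_neutral : set Q := quot_homog 1%g.

Definition unit_in (A : set Q) (x : Q) : Prop :=
  exists2 y, A y & x * y = 1 /\ y * x = 1.

(* Independent of the decomposition s of 1 when x commutes with quot_neutral;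
   one exists because a faithful grading is strong. *)
Definition quot_conj (g : G) (x : Q) : Q :=
  xget 0 [set y | exists s : seq (Q * Q),
    [/\ forall p, p \in s -> quot_homog g p.1 /\ quot_homog (g^-1)%g p.2,
        \sum_(p <- s) p.1 * p.2 = 1
      & y = \sum_(p <- s) p.1 * x * p.2]].

Definition central_grouplike (x : Q) : Prop :=
  [/\ quot_neutral x, unit_in quot_neutral x,
      forall b, quot_neutral b -> x * b = b * x & grouplike x].

Record grouplike_splitting (u : N -> Q) : Prop := GrouplikeSplitting {
  gls_degree : forall n, quot_homog (val n) (u n);
  gls_grouplike : forall n, grouplike (u n);
  gls_unit : forall n, unit_in quot_sub (u n);
  gls_mul : forall n m, u n * u m = u (n * m)%g;
  gls_comm : forall n b, quot_neutral b -> u n * b = b * u n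
}.

Definition equivariant_family (u : N -> Q) : Prop :=
  grouplike_splitting u /\
  forall g n, quot_conj g (u n) = u (nsg_conj g n).

(* That J is a G-invariant quasi-Hopf ideal of H_e and that N is normal is part
   of their types. *)
Record character_datum (gamma : N -> Q) : Prop := CharacterDatum {
  cd_family : exists u, equivariant_family u;
  cd_grouplike : forall n, central_grouplike (gamma n);
  cd_mul : forall n m, gamma (n * m)%g = gamma n * gamma m;
  cd_equivariant : forall g n, quot_conj g (gamma n) = gamma (nsg_conj g n)
}.

Definition is_lift (g : G) (x : Q) (xt : H) : Prop := homog g xt /\ q xt = x.

Definition datum_ideal (ut gt : N -> H) : set H :=
  ideal_gen (lift_set J `|` [set ut n - gt n | n in setT]).

Definition ideal_over (I : set H) : Prop :=
  [/\ is_qhideal setT I, ideal_support I = [set g | g \in N]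
    & I `&` homog 1%g = J].

Definition retraction_of (I : set H) (tau : Q -> Q) : Prop :=
  [/\ is_qhmorphism quot_sub quot_neutral tau,
      forall b, quot_neutral b -> tau b = b
    & forall x, quot_sub x -> (tau x = 0 <-> (q @` (I `&` homog_sub)) x)].

End CharacterData.

Arguments quot_sub {k G H} N J.
Arguments character_datum {k G H} N J gamma.
Arguments equivariant_family {k G H} N J u.
Arguments retraction_of {k G H} N J I tau.
Arguments datum_ideal {k G H} N J ut gt.
Arguments is_lift {k G H} J g x xt.

(* Main.v *)
Require Import Defs.
From HB Require Import structures.
From mathcomp Require Import all_boot all_algebra.
From mathcomp Require Import boolp classical_sets monalg.

(* Multiplicativity and the antipode force two images p(H_g), p(H_h) in H/I to be
   equal as soon as they meet nontrivially: a nonzero common element yields one of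
   counit 1, and then 1 lies in p(H_g) p(H_h^{-1}) by the antipode axioms. Slicing
   the coproduct with linear forms shows moreover that pairwise disjoint images are
   independent. Hence n lies in N_I exactly when 1 lies in p(H_n), so H_n lies
   in H_e + I for n in N, and the projection of H/J^G onto H_e/J along I/J^G restricts to the
   retraction; I is recovered by moving the terms of a relation lying in the same
   coset of N to a common degree.
   Conversely, with v_n = gamma(n)^{-1} u_n, the map multiplying the component of
   degree m in N by v_{m^{-1}} and killing the other ones vanishes on I_gamma and is
   the projection on H_e; this gives both I_gamma /\ H_e = J and the support N. *)

Set Implicit Arguments.
Unset Strict Implicit.
Unset Printing Implicit Defensive.

Import GRing.Theory.

Local Open Scope classical_set_scope.
Local Open Scope ring_scope.

(** * Subspaces and tensor products *)

(** The images of the components in H/I may overlap, so H/I need not be graded. The record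
    [pregraded] keeps the properties of a grading other than directness, and the same arguments then
    serve H, H/J^G and H/I. A nonzero y yields an element of counit 1 in its own component by
    slicing its coproduct with a form f such that f(y) = 1: the slice has counit f(y). The map that
    vanishes on I_gamma has a simple origin. Modulo J^G an element of degree n in N is uniquely b
    v_n with b neutral, so H_N/J^N is H_e/J tensored with k[N], and the map sends b v_n to b. One
    linear map that kills the ideal bounds it from above without any description of its elements. A
    retraction is linear only on the image of H_N, so its tensor square is not defined everywhere.
    It is compared with a projector that is linear on all of H/J^G and agrees with it on the image
    of H_N. *)

Section LinearAlgebra.
Variable k : fieldType.
Implicit Types U V W : lmodType k.

Lemma subspaceZ V (X : set V) c x : subspace X -> X x -> X (c *: x).
Proof. by move=> [X0 Xl] Xx; rewrite -[c *: x]addr0; apply: Xl. Qed.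

Lemma subspaceN V (X : set V) x : subspace X -> X x -> X (- x).
Proof. by move=> hX Xx; rewrite -scaleN1r; apply: subspaceZ. Qed.

Lemma subspaceB V (X : set V) x y : subspace X -> X x -> X y -> X (x - y).
Proof. by move=> hX Xx Xy; apply: subspaceD => //; apply: subspaceN. Qed.

Lemma subspace_sum V (X : set V) (I : eqType) (s : seq I) (P : pred I) (F : I -> V) :
  subspace X -> (forall i, i \in s -> P i -> X (F i)) ->
  X (\sum_(i <- s | P i) F i).
Proof.
move=> hX XF; rewrite big_seq_cond; elim/big_ind: _ => [||i /andP[]]; last exact: XF.
- by case: hX.
- by move=> x y; apply: subspaceD.
Qed.

Lemma subspace_image V W (f : {linear V -> W}) (X : set V) :
  subspace X -> subspace (f @` X).
Proof.
move=> [X0 Xl]; split; first by exists 0; rewrite ?linear0.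
by move=> c _ _ [x Xx <-] [y Xy <-]; exists (c *: x + y); [apply: Xl | rewrite linearP].
Qed.

Lemma linspanS V (X Y : set V) : X `<=` Y -> linspan X `<=` linspan Y.
Proof.
by move=> XY; apply: linspan_sub; [apply: linspan_subspace | move=> x /XY /linspan_in].
Qed.

Lemma linspan_image V W (f : {linear V -> W}) (X : set V) (Y : set W) x :
  subspace Y -> (forall y, X y -> Y (f y)) -> linspan X x -> Y (f x).
Proof.
by move=> hY XY; apply: (linspan_sub (subspace_preim f hY)) => y; apply: XY.
Qed.

(* A maximal subspace containing K and meeting M trivially is a complement of M. *)
Lemma ex_projector V (M K : set V) : subspace M -> subspace K ->
  (forall x, M x -> K x -> x = 0) ->
  exists P : {linear V -> V},
    [/\ forall x, M (P x), forall x, M x -> P x = x & forall x, K x -> P x = 0].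
Proof.
move=> hM hK MK.
(* The alternative [W = set0] accounts for the empty chain, whose union does not contain [K];
   maximality excludes it for the final [W]. *)
pose Q (W : set V) := [/\ forall c x y, W x -> W y -> W (c *: x + y),
  forall x, M x -> W x -> x = 0 & W = set0 \/ K `<=` W].
have [|W [[Wl MW KW] Wmax]] := @Zorn_bigcup V Q.
  move=> F FQ Ftot; split.
  - move=> c x y [X FX Xx] [Y FY Yy].
    have [XY|YX] := Ftot _ _ FX FY.
      by exists Y => //; have [Yl _ _] := FQ _ FY; apply: Yl => //; apply: XY.
    by exists X => //; have [Xl _ _] := FQ _ FX; apply: Xl => //; apply: YX.
  - by move=> x Mx [X FX Xx]; have [_ h _] := FQ _ FX; apply: h.
  - have [[X [FX KX]]|h] := pselect (exists X, F X /\ K `<=` X).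
      by right=> x /KX Xx; exists X.
    left; apply/seteqP; split=> // x [X FX Xx].
    have [_ _ [X0|KX]] := FQ _ FX; first by rewrite X0 in Xx.
    by case: h; exists X.
have W0 : W 0.
  case: KW => [W0|]; last by apply; case: hK.
  exfalso; apply: (Wmax K); last by split=> //; [case: hK | right].
  by rewrite W0; split=> // h; case: hK => K0 _; apply: (h 0).
have KsubW : K `<=` W by case: KW => // W00; move: W0; rewrite W00.
have hW : subspace W by [].
have ex x : exists m, M m /\ W (x - m).
  have [Wx|NWx] := pselect (W x); first by exists 0; rewrite subr0; case: hM.
  apply: contrapT => nex.
  pose B := [set y | exists2 w, W w & exists a, y = w + a *: x].
  apply: (Wmax B).
    split=> [w Ww|/(_ x) WB]; first by exists w => //; exists 0; rewrite scale0r addr0.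
    by apply/NWx/WB; exists 0 => //; exists 1; rewrite scale1r add0r.
  split; last first.
  - by right=> y /KsubW Wy; exists y => //; exists 0; rewrite scale0r addr0.
  (* If [a] is nonzero, solving [m = w + a *: x] for [x] splits [x] along [M] and [W], against
     [nex]. *)
  - move=> m Mm [w Ww [a ma]]; have [a0|a0] := eqVneq a 0.
      by apply: MW => //; rewrite ma a0 scale0r addr0.
    case: nex; exists (a^-1 *: m); split; first exact: subspaceZ.
    rewrite ma scalerDr scalerA mulVf // scale1r opprD addrCA subrr addr0.
    by rewrite -scalerN; apply: subspaceZ => //; apply: subspaceN.
  - move=> c y z [w Ww [a ->]] [w' Ww' [a' ->]].
    exists (c *: w + w'); first exact: Wl.
    by exists (c * a + a'); rewrite scalerDr scalerDl scalerA addrACA.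
have uniq x m m' : M m -> W (x - m) -> M m' -> W (x - m') -> m = m'.
  move=> Mm h Mm' h'; apply/eqP; rewrite -subr_eq0; apply/eqP.
  apply: MW; first exact: subspaceB.
  have -> : m - m' = (x - m') - (x - m) by rewrite opprB [RHS]addrC addrA subrK.
  exact: subspaceB.
pose p x := xget 0 [set m | M m /\ W (x - m)].
have pP x : M (p x) /\ W (x - p x) by exact: (xgetPex 0 (ex x)).
have pE x m : M m -> W (x - m) -> p x = m.
  by move=> Mm Wm; have [h1 h2] := pP x; apply: (uniq x).
have pl : linear p.
  move=> c x y; have [hx1 hx2] := pP x; have [hy1 hy2] := pP y.
  apply: pE; first by apply: hM.2.
  by rewrite opprD addrACA -scalerBr; apply: Wl.
pose P : {linear V -> V} := HB.pack p (GRing.isLinear.Build k V V _ p pl).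
exists P; split=> [x|x Mx|x Kx] /=.
- by case: (pP x).
- by apply: pE => //; rewrite subrr.
- by apply: pE; [case: hM | rewrite subr0; apply: KsubW].
Qed.

(** For a projector [P] onto [M], a form with value 1 at the nonzero vector [y - P y] is composed
    with [id - P], which kills [M]. *)
Lemma ex_separating_form V (M : set V) y : subspace M -> ~ M y ->
  exists f : {linear V -> k^o}, (forall x, M x -> f x = 0) /\ f y = 1.
Proof.
move=> hM My.
have h0 : subspace [set (0 : V)] by split=> // c x z -> ->; rewrite scaler0 addr0.
have [P [PM Pid _]] := ex_projector hM h0 (fun _ _ => id).
have y0 : y - P y != 0 by apply/eqP => /subr0_eq h; apply: My; rewrite h.
have [phi phil phi1] := ex_linear_form y0.
have phi'l : linear ((fun x => phi (x - P x)) : V -> k^o).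
  by move=> c x z; rewrite linearP opprD addrACA -scalerBr phil.
pose f : {linear V -> k^o} := HB.pack ((fun x => phi (x - P x)) : V -> k^o)
  (GRing.isLinear.Build k V k^o _ _ phi'l).
exists f; split=> //= x Mx.
rewrite Pid // subrr; apply: (addrI (phi 0)).
by have := phil 1 0 0; rewrite scale1r addr0 mul1r addr0 => <-.
Qed.

Lemma tens0l U V (v : V) : (0 : U) \ot v = 0.
Proof. by rewrite -(scale0r 0) tensZl scale0r. Qed.

Lemma tens0r U V (u : U) : u \ot (0 : V) = 0.
Proof. by rewrite -(scale0r 0) tensZr scale0r. Qed.

Lemma tensBl U V (u u' : U) (v : V) : (u - u') \ot v = u \ot v - u' \ot v.
Proof. by rewrite tensDl -scaleN1r tensZl scaleN1r. Qed.

Lemma tensBr U V (u : U) (v v' : V) : u \ot (v - v') = u \ot v - u \ot v'.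
Proof. by rewrite tensDr -scaleN1r tensZr scaleN1r. Qed.

Lemma tensset_in U V (X : set U) (Y : set V) u v :
  X u -> Y v -> tensset X Y (u \ot v).
Proof. by move=> Xu Yv; apply: linspan_in; exists u => //; exists v. Qed.

Lemma tenssetS U V (X X' : set U) (Y Y' : set V) :
  X `<=` X' -> Y `<=` Y' -> tensset X Y `<=` tensset X' Y'.
Proof.
move=> XX YY; apply: linspanS => _ [x /XX Xx [y /YY Yy <-]].
by exists x => //; exists y.
Qed.

Lemma tensset_subspace U V (X : set U) (Y : set V) : subspace (tensset X Y).
Proof. exact: linspan_subspace. Qed.

Lemma tenssetT U V (t : U \ot V) : tensset setT setT t.
Proof.
elim/tensor_ind: t => [|x y|u v]; first by case: (tensset_subspace [set: U] [set: V]).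
  by move=> hx hy; apply: subspaceD => //; exact: tensset_subspace.
exact: tensset_in.
Qed.

Lemma tensset_tmap U V U' V' (f : {linear U -> U'}) (g : {linear V -> V'})
    (X : set U) (Y : set V) (X' : set U') (Y' : set V') t :
  (forall x, X x -> X' (f x)) -> (forall y, Y y -> Y' (g y)) ->
  tensset X Y t -> tensset X' Y' (tmap f g t).
Proof.
move=> XX YY; apply: linspan_image; first exact: tensset_subspace.
by move=> _ [x Xx [y Yy <-]]; rewrite /= tmapE; apply: tensset_in; auto.
Qed.

Lemma tensset_sum U V (X : set U) (Y : set V) t : subspace X ->
  tensset X Y t -> exists s : seq (U * V),
    (forall p, p \in s -> X p.1 /\ Y p.2) /\ t = \sum_(p <- s) p.1 \ot p.2.
Proof.
move=> hX [s sXY ->]; elim: s sXY => [|[c z] s IHs] sXY.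
  by exists [::]; rewrite !big_nil.
have [|r [rXY re]] := IHs; first by move=> p ps; apply: sXY; rewrite inE ps orbT.
have [|x Xx [y Yy /= xy]] := sXY (c, z); first by rewrite inE eqxx.
exists ((c *: x, y) :: r); split; last by rewrite !big_cons re -xy /= tensZl.
by move=> p; rewrite inE => /orP[/eqP -> /=|/rXY //]; split=> //; apply: subspaceZ.
Qed.

Lemma tensset3_sum U V W (X : set U) (Y : set V) (Z : set W) t : subspace X -> subspace Y ->
  tensset X (tensset Y Z) t -> exists s : seq (U * V * W),
    (forall p, p \in s -> [/\ X p.1.1, Y p.1.2 & Z p.2]) /\
    t = \sum_(p <- s) p.1.1 \ot (p.1.2 \ot p.2).
Proof.
move=> hX hY /(tensset_sum hX) [s [sP ->]].
elim: s sP => [|[x r] s IHs] sP; first by exists [::]; rewrite !big_nil.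
have [|s' [s'P e]] := IHs; first by move=> p ps; apply: sP; rewrite inE ps orbT.
have [/= Xx /(tensset_sum hY) [r' [r'P re]]] := sP (x, r) (mem_head _ _).
exists ([seq (x, p.1, p.2) | p <- r'] ++ s'); split.
  by move=> p; rewrite mem_cat => /orP[/mapP [a /r'P [a1 a2] ->]|/s'P].
rewrite big_cons big_cat big_map /= re -e; congr (_ + _).
by elim/big_rec2: _ => [|p y1 y2 _ <-]; rewrite ?tens0r ?tensDr.
Qed.

Lemma tmap_id U V (f : {linear U -> U}) (g : {linear V -> V})
    (X : set U) (Y : set V) t :
  (forall x, X x -> f x = x) -> (forall y, Y y -> g y = y) ->
  tensset X Y t -> tmap f g t = t.
Proof.
move=> fX gY [s sXY ->]; rewrite linear_sum; apply: eq_big_seq => -[c z] /sXY.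
by move=> [x Xx [y Yy /= <-]]; rewrite linearZ /= tmapE fX ?gY.
Qed.

Lemma tmap_eq0 U V U' V' (f : {linear U -> U'}) (g : {linear V -> V'})
    (X : set U) (Y : set V) t :
  (forall x, X x -> f x = 0) -> (forall y, Y y -> g y = 0) ->
  sumset (tensset X setT) (tensset setT Y) t -> tmap f g t = 0.
Proof.
move=> fX gY; apply: linspan0 => y [|]; apply: linspan0.
- by move=> _ [a Xa [b _ <-]]; rewrite /= tmapE fX // tens0l.
- by move=> _ [a _ [b Yb <-]]; rewrite /= tmapE gY // tens0r.
Qed.

Lemma tlift_tensset U V W (F : U -> V -> W) (X : set U) (Y : set V) (Z : set W) t :
  bilinear_over F -> (forall c u v, F (c *: u) v = c *: F u v) -> subspace Z ->
  (forall x y, X x -> Y y -> Z (F x y)) -> tensset X Y t -> Z (tlift F t).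
Proof.
move=> FB FZ hZ XYZ.
pose f : {linear (U \ot V)%type -> W} :=
  HB.pack (tlift F) (GRing.isLinear.Build k _ _ _ _ (tlift_linear FB FZ)).
apply: (@linspan_image _ _ f _ Z t hZ).
by move=> _ [x Xx [y Yy <-]]; rewrite /= (tliftE FB); apply: XYZ.
Qed.

(** This is [f \ot id], with k tensor V identified with V. Applied to the coproduct of an element of
    a component, it stays in that component. *)
Definition slice U V (f : U -> k^o) : U \ot V -> V := tlift (fun a b => (f a : k) *: b).

Section Slice.
Variables (U V : lmodType k) (f : {linear U -> k^o}).

Lemma slice_bilinear : bilinear_over (fun (a : U) (b : V) => (f a : k) *: b).
Proof.
split=> [b x y|a x y|c a b] /=.
- by rewrite linearD scalerDl.
- by rewrite scalerDr.
- by rewrite [f (_ *: _)]linearZ [RHS]scalerA mulrC.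
Qed.

Lemma sliceE u v : slice f (u \ot v : U \ot V) = (f u : k) *: v.
Proof. exact: (tliftE slice_bilinear). Qed.

Lemma slice_is_linear : linear (slice f : U \ot V -> V).
Proof.
apply: tlift_linear; first exact: slice_bilinear.
by move=> c u v; rewrite linearZ [RHS]scalerA.
Qed.

HB.instance Definition _ :=
  GRing.isLinear.Build k (tensor U V) V _ (slice f) slice_is_linear.

Lemma slice_tensset (X : set U) (Y : set V) t : subspace Y ->
  tensset X Y t -> Y (slice f t).
Proof.
move=> hY; apply: linspan_image => // _ [x _ [y Yy <-]].
by rewrite /= sliceE; apply: subspaceZ.
Qed.

Lemma slice_eq0 (X : set U) (Y : set V) t : (forall x, X x -> f x = 0) ->
  tensset X Y t -> slice f t = 0.
Proof.
by move=> fX; apply: linspan0 => _ [x Xx [y _ <-]]; rewrite /= sliceE fX // scale0r.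
Qed.

End Slice.

(** A projector onto [X], applied to the first factor, fixes the elements of [X \ot V] and carries
    those of [U \ot Y] into [X \ot Y]. *)
Lemma tensset_cap U V (X : set U) (Y : set V) t : subspace X ->
  tensset X setT t -> tensset setT Y t -> tensset X Y t.
Proof.
move=> hX hXt hYt.
have h0 : subspace [set (0 : U)] by split=> // c x z -> ->; rewrite scaler0 addr0.
have [P [PX Pid _]] := ex_projector hX h0 (fun _ _ => id).
have <- : tmap P idfun t = t by apply: tmap_id hXt => //.
by apply: tensset_tmap hYt.
Qed.

(** The sections [r] and [r'] are mere maps of sets, such as choices of representatives. Their
    failure to be linear takes values in the kernels, so each defining relation of the tensor
    product lifts up to kernel terms. *)
Lemma tensor_rel_section U V U' V' (p : {linear U -> U'}) (q : {linear V -> V'})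
    (r : U' -> U) (r' : V' -> V) (s t : seq (U' * V')) :
  cancel r p -> cancel r' q -> tensor_rel s t ->
  sumset (tensset [set x | p x = 0] setT) (tensset setT [set y | q y = 0])
    (\sum_(i <- s) r i.1 \ot r' i.2 - \sum_(i <- t) r i.1 \ot r' i.2).
Proof.
move=> rK r'K; set K := sumset _ _; have hK : subspace K by exact: linspan_subspace.
have Kl x y : p x = 0 -> K (x \ot y).
  by move=> px; apply: linspan_in; left; apply: tensset_in.
have Kr x y : q y = 0 -> K (x \ot y).
  by move=> qy; apply: linspan_in; right; apply: tensset_in.
elim=> {s t}.
- by move=> s; rewrite subrr; case: hK.
- by move=> s t _ h; rewrite -opprB; apply: subspaceN.
- by move=> s t r0 _ h1 _ h2; have := subspaceD hK h1 h2; rewrite addrA subrK.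
- by move=> s s' t t' _ h1 _ h2; rewrite !big_cat /= opprD addrACA; apply: subspaceD.
- by move=> s t; rewrite !big_cat /= addrC subrr; case: hK.
- by move=> v; rewrite big_seq1 big_nil subr0; apply: Kl; rewrite rK.
- move=> u u' v; rewrite !big_cons !big_nil !addr0 /= -tensDl -tensBl.
  by apply: Kl; rewrite linearB linearD /= !rK subrr.
- move=> u v v'; rewrite !big_cons !big_nil !addr0 /= -tensDr -tensBr.
  by apply: Kr; rewrite linearB linearD /= !r'K subrr.
- move=> c u v; rewrite !big_seq1 /=.
  have -> : r (c *: u) \ot r' v - r u \ot r' (c *: v) =
      (r (c *: u) - c *: r u) \ot r' v + r u \ot (c *: r' v - r' (c *: v)).
    by rewrite tensBl tensBr tens_scale addrA subrK.
  apply: subspaceD => //; first by apply: Kl; rewrite linearB linearZ /= !rK subrr.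
  by apply: Kr; rewrite linearB linearZ /= !r'K subrr.
Qed.

(** Right exactness of the tensor product: a relation between the images lifts along the sections up
    to kernel terms, and each [u \ot v] differs from its lift by such terms. It brings identities in
    the tensor square of a quotient back to [H]. *)
Lemma ker_tmap U V U' V' (p : {linear U -> U'}) (q : {linear V -> V'})
    (r : U' -> U) (r' : V' -> V) (t : U \ot V) :
  cancel r p -> cancel r' q -> tmap p q t = 0 ->
  sumset (tensset [set x | p x = 0] setT) (tensset setT [set y | q y = 0]) t.
Proof.
move=> rK r'K; have [s ->] := tensorP t; set K := sumset _ _.
have hK : subspace K by exact: linspan_subspace.
rewrite linear_sum /= (eq_bigr (fun i => p i.1 \ot q i.2)) => [|i _]; last by rewrite tmapE.
rewrite -(big_map (fun i => (p i.1, q i.2)) xpredT (fun i => i.1 \ot i.2)) -tmkE -tmk0.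
move=> /tmkP /(tensor_rel_section rK r'K); rewrite big_nil subr0 big_map => h.
rewrite -[\sum_(i <- s) _](subrK (\sum_(i <- s) r (p i.1) \ot r' (q i.2))).
apply: subspaceD => //; rewrite -sumrB; apply: subspace_sum => // -[u v] _ _ /=.
have -> : u \ot v - r (p u) \ot r' (q v) =
    (u - r (p u)) \ot v + r (p u) \ot (v - r' (q v)).
  by rewrite tensBl tensBr addrA subrK.
apply: subspaceD => //; apply: linspan_in; [left|right]; apply: tensset_in => //=.
- by rewrite linearB /= rK subrr.
- by rewrite linearB /= r'K subrr.
Qed.

Lemma prodset_in (A : algType k) (X Y : set A) x y :
  X x -> Y y -> prodset X Y (x * y).
Proof. by move=> Xx Yy; apply: linspan_in; exists x => //; exists y. Qed.

Lemma prodset_sum (A : algType k) (X Y : set A) z : subspace X ->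
  prodset X Y z -> exists s : seq (A * A),
    (forall p, p \in s -> X p.1 /\ Y p.2) /\ z = \sum_(p <- s) p.1 * p.2.
Proof.
move=> hX [s sXY ->]; elim: s sXY => [|[c w] s IHs] sXY.
  by exists [::]; rewrite !big_nil.
have [|r [rXY re]] := IHs; first by move=> p ps; apply: sXY; rewrite inE ps orbT.
have [|x Xx [y Yy /= xy]] := sXY (c, w); first by rewrite inE eqxx.
exists ((c *: x, y) :: r); split; last by rewrite !big_cons re -xy /= scalerAl.
by move=> p; rewrite inE => /orP[/eqP -> /=|/rXY //]; split=> //; apply: subspaceZ.
Qed.

Lemma mull_subspace (A : algType k) (a : A) (Y : set A) :
  subspace Y -> subspace [set x | Y (a * x)].
Proof.
move=> [Y0 Yl]; split=> /= [|c x y]; first by rewrite mulr0.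
by move=> hx hy; rewrite mulrDr -scalerAr; apply: Yl.
Qed.

Lemma mulr_subspace (A : algType k) (a : A) (Y : set A) :
  subspace Y -> subspace [set x | Y (x * a)].
Proof.
move=> [Y0 Yl]; split=> /= [|c x y]; first by rewrite mul0r.
by move=> hx hy; rewrite mulrDl -scalerAl; apply: Yl.
Qed.

Lemma sumset_tensS (U V : lmodType k) (X X' : set U) (Y Y' : set V) :
  X `<=` X' -> Y `<=` Y' ->
  sumset (tensset X setT) (tensset setT Y) `<=` sumset (tensset X' setT) (tensset setT Y').
Proof.
move=> XX YY; apply: linspanS => t [] h; [left|right]; apply: tenssetS h => //.
Qed.

Lemma sumset_tens_mull (A B : algType k) (X : set A) (Y : set B) (s t : A \ot B) :
  (forall a x, X x -> X (a * x)) -> (forall b y, Y y -> Y (b * y)) ->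
  sumset (tensset X setT) (tensset setT Y) t ->
  sumset (tensset X setT) (tensset setT Y) (s * t).
Proof.
move=> Xl Yl; set K := sumset _ _; have hK : subspace K by exact: linspan_subspace.
have hsK := mull_subspace s hK.
move: t; apply: linspan_sub => // t []; move: t; apply: linspan_sub => //.
- move=> _ [x Xx [y _ <-]] /=; elim/tensor_ind: s {hsK} => [|s s' hs hs'|a b].
  + by rewrite mul0r; case: hK.
  + by rewrite mulrDl; apply: subspaceD.
  + by rewrite tensM; apply: linspan_in; left; apply: tensset_in => //; apply: Xl.
- move=> _ [x _ [y Yy <-]] /=; elim/tensor_ind: s {hsK} => [|s s' hs hs'|a b].
  + by rewrite mul0r; case: hK.
  + by rewrite mulrDl; apply: subspaceD.
  + by rewrite tensM; apply: linspan_in; right; apply: tensset_in => //; apply: Yl.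
Qed.

Lemma sumset_tens_mulr (A B : algType k) (X : set A) (Y : set B) (s t : A \ot B) :
  (forall a x, X x -> X (x * a)) -> (forall b y, Y y -> Y (y * b)) ->
  sumset (tensset X setT) (tensset setT Y) t ->
  sumset (tensset X setT) (tensset setT Y) (t * s).
Proof.
move=> Xr Yr; set K := sumset _ _; have hK : subspace K by exact: linspan_subspace.
have hsK := mulr_subspace s hK.
move: t; apply: linspan_sub => // t []; move: t; apply: linspan_sub => //.
- move=> _ [x Xx [y _ <-]] /=; elim/tensor_ind: s {hsK} => [|s s' hs hs'|a b].
  + by rewrite mulr0; case: hK.
  + by rewrite mulrDr; apply: subspaceD.
  + by rewrite tensM; apply: linspan_in; left; apply: tensset_in => //; apply: Xr.
- move=> _ [x _ [y Yy <-]] /=; elim/tensor_ind: s {hsK} => [|s s' hs hs'|a b].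
  + by rewrite mulr0; case: hK.
  + by rewrite mulrDr; apply: subspaceD.
  + by rewrite tensM; apply: linspan_in; right; apply: tensset_in => //; apply: Yr.
Qed.

Lemma tmap_mull (A B : algType k) (f : {linear A -> A}) (x : A) (y : B) t :
  (forall a, f (x * a) = x * f a) ->
  tmap f (idfun : {linear B -> B}) ((x \ot y) * t) =
  (x \ot y) * tmap f (idfun : {linear B -> B}) t.
Proof.
move=> fx; elim/tensor_ind: t => [|t t' ht ht'|a b].
- by rewrite !(mulr0, linear0).
- by rewrite !mulrDr !linearD /= ht ht' mulrDr.
- by rewrite tensM !(tmapE f idfun) /= fx tensM.
Qed.

End LinearAlgebra.

(** * Two-sided ideals generated by a set *)

Section IdealGen.
Variables (k : fieldType) (A : algType k) (X : set A).

Lemma ideal_gen_subspace : subspace (ideal_gen X).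
Proof. exact: linspan_subspace. Qed.

Lemma ideal_gen_in x : X x -> ideal_gen X x.
Proof. by move=> Xx; apply: linspan_in; exists 1, x, 1; rewrite mul1r mulr1. Qed.

Lemma ideal_gen_mull a x : ideal_gen X x -> ideal_gen X (a * x).
Proof.
move: x; apply: linspan_sub; first exact/mull_subspace/ideal_gen_subspace.
by move=> _ [b [x [c [Xx ->]]]] /=; apply: linspan_in; exists (a * b), x, c; rewrite !mulrA.
Qed.

Lemma ideal_gen_mulr a x : ideal_gen X x -> ideal_gen X (x * a).
Proof.
move: x; apply: linspan_sub; first exact/mulr_subspace/ideal_gen_subspace.
by move=> _ [b [x [c [Xx ->]]]] /=; apply: linspan_in; exists b, x, (c * a); rewrite !mulrA.
Qed.

Lemma ideal_gen_sub (Y : set A) : subspace Y ->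
  (forall a x, Y x -> Y (a * x)) -> (forall a x, Y x -> Y (x * a)) ->
  X `<=` Y -> ideal_gen X `<=` Y.
Proof.
move=> hY Yl Yr XY; apply: linspan_sub => // _ [a [x [b [Xx ->]]]].
by apply/Yr/Yl/XY.
Qed.

End IdealGen.

(** * Homogeneous components *)

Section HomogeneousComponents.
Variables (k : fieldType) (G : groupType) (H : gradedQuasiHopf k G).

Definition hdec (x : H) : seq (G * H) := s2val (cid2 (graded_span (gqhP H) x)).

Lemma hdecP x p : p \in hdec x -> homog p.1 p.2.
Proof. by move: p; exact: (s2valP (cid2 (graded_span (gqhP H) x))). Qed.

Lemma hdecE x : x = \sum_(p <- hdec x) p.2.
Proof. exact: (s2valP' (cid2 (graded_span (gqhP H) x))). Qed.

Lemma homog_subspace g : subspace (@homog k G H g).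
Proof. exact: graded_subspace (gqhP H) g. Qed.

Section Extension.
Variables (W : lmodType k) (F : G -> H -> W).
Hypothesis Fl : forall g, linear (F g).

(** The map on [H] that restricts to [F g] in degree [g]; [hsum_sum] shows that the chosen
    decomposition does not matter. *)
Definition hsum (x : H) : W := \sum_(p <- hdec x) F p.1 p.2.

Lemma homog_sum_eq0 (s : seq (G * H)) : (forall p, p \in s -> homog p.1 p.2) ->
  \sum_(p <- s) p.2 = 0 -> \sum_(p <- s) F p.1 p.2 = 0.
Proof.
move=> sP s0.
pose f g : {linear H -> W} := HB.pack (F g) (GRing.isLinear.Build k _ _ _ _ (Fl g)).
have fE g x : F g x = f g x by [].
pose u := undup (map fst s); have uu : uniq u by exact: undup_uniq.
have group (V : zmodType) (E : G -> H -> V) : \sum_(p <- s) E p.1 p.2 =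
    \sum_(g <- u) \sum_(p <- s | p.1 == g) E g p.2.
  rewrite (exchange_big_dep xpredT) //= big_seq [RHS]big_seq; apply: eq_bigr => p ps.
  rewrite -big_filter (eq_filter (a2 := pred1 p.1)); last by move=> g; rewrite /= eq_sym.
  by rewrite filter_pred1_uniq ?big_seq1 // mem_undup map_f.
rewrite group big_seq big1 // => g gu.
under eq_bigr => p _ do rewrite fE.
rewrite -linear_sum /=.
rewrite (graded_direct (gqhP H) (x := fun g => \sum_(p <- s | p.1 == g) p.2) uu) //.
- exact: (linear0 (f g)).
- move=> h; apply: subspace_sum; first exact: homog_subspace.
  by move=> p /sP + /eqP <-.
- by rewrite -(group _ (fun _ x => x)).
Qed.

Lemma hsum_sum (s : seq (G * H)) : (forall p, p \in s -> homog p.1 p.2) ->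
  hsum (\sum_(p <- s) p.2) = \sum_(p <- s) F p.1 p.2.
Proof.
move=> sP; apply/eqP; rewrite -subr_eq0; apply/eqP.
set x := \sum_(p <- s) p.2.
pose f g : {linear H -> W} := HB.pack (F g) (GRing.isLinear.Build k _ _ _ _ (Fl g)).
have := @homog_sum_eq0 (hdec x ++ [seq (p.1, - p.2) | p <- s]).
rewrite !big_cat /= !big_map /= sumrN -hdecE subrr.
have -> : \sum_(p <- s) F p.1 (- p.2) = - \sum_(p <- s) F p.1 p.2.
  by rewrite -sumrN; apply: eq_bigr => p _; exact: (linearN (f p.1)).
apply=> // p; rewrite mem_cat => /orP[/hdecP //|/mapP [r /sP rP ->]].
exact: subspaceN (homog_subspace _) rP.
Qed.

Lemma hsum_homog g x : homog g x -> hsum x = F g x.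
Proof.
move=> gx; have := @hsum_sum [:: (g, x)]; rewrite !big_seq1; apply=> p.
by rewrite inE => /eqP ->.
Qed.

Lemma hsum_linear : linear hsum.
Proof.
move=> c x y.
pose f g : {linear H -> W} := HB.pack (F g) (GRing.isLinear.Build k _ _ _ _ (Fl g)).
rewrite {1}(hdecE x) {1}(hdecE y).
have := @hsum_sum ([seq (p.1, c *: p.2) | p <- hdec x] ++ hdec y).
rewrite !big_cat /= !big_map /= -scaler_sumr => ->.
  congr (_ + _); rewrite /hsum scaler_sumr; apply: eq_bigr => p _.
  by rewrite -[LHS]/(f p.1 _) linearZ.
move=> p; rewrite mem_cat => /orP[/mapP [r /hdecP rP ->]|/hdecP //].
exact: subspaceZ (homog_subspace _) rP.
Qed.

End Extension.

Lemma homog_ind (P : H -> Prop) : subspace P -> (forall g x, homog g x -> P x) ->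
  forall x, P x.
Proof.
by move=> hP hh x; rewrite (hdecE x); apply: subspace_sum => // p /hdecP /hh.
Qed.

Definition hcomp g : H -> H := hsum (fun h x => if h == g then x else 0).

Arguments hcomp : simpl never.

Lemma hcomp_is_linear g : linear (hcomp g).
Proof. by apply: hsum_linear => h c x y; case: eqP => //; rewrite scaler0 addr0. Qed.

HB.instance Definition _ g :=
  GRing.isLinear.Build k H H _ (hcomp g) (hcomp_is_linear g).

Lemma hcomp_homog g h x : homog h x -> hcomp g x = if h == g then x else 0.
Proof.
by apply: hsum_homog => {}h c {}x y; case: eqP => //; rewrite scaler0 addr0.
Qed.

Lemma hcomp_sum g (s : seq (G * H)) : (forall p, p \in s -> homog p.1 p.2) ->
  hcomp g (\sum_(p <- s) p.2) = \sum_(p <- s | p.1 == g) p.2.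
Proof.
move=> sP; rewrite [LHS]hsum_sum // => [|h c x y]; first by rewrite [RHS]big_mkcond.
by case: eqP => //; rewrite scaler0 addr0.
Qed.

Lemma hcompP g x : homog g (hcomp g x).
Proof.
elim/homog_ind: x => [|h x hx].
  exact: (subspace_preim (hcomp g) (homog_subspace g)).
by rewrite (hcomp_homog _ hx); case: eqP => [<- //|_]; case: (homog_subspace g).
Qed.

(** This is not among the fields of [is_graded]. Comparing the parts of degree [g] in [x * 1 = x],
    for [x] of degree [g], shows that the neutral part of 1 is a right identity, hence equals 1. *)
Lemma homog1 : homog 1%g (1 : H).
Proof.
suff -> : (1 : H) = hcomp 1%g 1 by exact: hcompP.
rewrite -[RHS]mul1r.
have : forall x : H, x * hcomp 1%g 1 = x; last by move=> ->.
apply: homog_ind => [|g x gx].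
  split=> [|c x y /= hx hy]; first by rewrite mul0r.
  by rewrite mulrDl -scalerAl hx hy.
have h : hcomp g (x * 1) = x * hcomp 1%g 1.
  rewrite {1}(hdecE 1) mulr_sumr linear_sum /= /hcomp {2}/hsum mulr_sumr.
  apply: eq_big_seq => p /hdecP pP; rewrite -/(hcomp g _).
  rewrite (hcomp_homog _ (graded_mul (gqhP H) gx pP)).
  rewrite -[X in _ == X]mulg1 (inj_eq (mulgI g)).
  by case: ifP => //; rewrite mulr0.
by rewrite -h mulr1 (hcomp_homog _ gx) eqxx.
Qed.

Lemma hcompMl g x y : homog 1%g x -> hcomp g (x * y) = x * hcomp g y.
Proof.
move=> hx; elim/homog_ind: y => [|h y hy].
  split=> [|c y z /= hy hz]; first by rewrite !(mulr0, linear0).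
  by rewrite mulrDr -scalerAr !linearP /= hy hz mulrDr -scalerAr.
rewrite (hcomp_homog _ hy) (hcomp_homog _ (graded_mul (gqhP H) hx hy)) mul1g.
by case: eqP => //; rewrite mulr0.
Qed.

Lemma hcompMr g x y : homog 1%g y -> hcomp g (x * y) = hcomp g x * y.
Proof.
move=> hy; elim/homog_ind: x => [|h x hx].
  split=> [|c x z /= hx hz]; first by rewrite !(mul0r, linear0).
  by rewrite mulrDl -scalerAl !linearP /= hx hz mulrDl -scalerAl.
rewrite (hcomp_homog _ hx) (hcomp_homog _ (graded_mul (gqhP H) hx hy)) mulg1.
by case: eqP => //; rewrite mul0r.
Qed.

(* The degree-e part of Phi_inv in the first tensor factor is again an inverse
   of Phi, because Phi has degree e. *)
Lemma graded_Phi_inv : tensset (homog 1%g) setT (Phi_inv : H \ot (H \ot H)).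
Proof.
pose P : {linear H -> H} := hcomp 1%g; pose Id : {linear (H \ot H)%type -> (H \ot H)%type} := idfun.
have PM t : tmap P Id ((Phi : H \ot (H \ot H)) * t) = Phi * tmap P Id t.
  have [s [sP ->]] := tensset_sum (homog_subspace _) (graded_Phi (gqhP H)).
  rewrite !mulr_suml linear_sum; apply: eq_big_seq => p /sP [p1 _].
  by apply: tmap_mull => a; exact: hcompMl.
have <- : tmap P Id (Phi_inv : H \ot (H \ot H)) = Phi_inv.
  rewrite -[LHS]mul1r -(@Phi_mulVl k H) -mulrA -PM Phi_mulV.
  by rewrite -tens1 tmapE /= (hcomp_homog _ homog1) eqxx mulr1.
by apply: tensset_tmap (tenssetT _) => // x _; exact: hcompP.
Qed.

Lemma grading_mapE (x : H) g :
  (grading_map x)@_g = counit (hcomp g x) :> k.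
Proof.
rewrite /grading_map; case: xgetP => [f _ [s [sP ->] ->]|].
  rewrite hcomp_sum // raddf_sum linear_sum [RHS]big_mkcond.
  by apply: eq_bigr => p _ /=; rewrite mcoeffU; case: eqP.
move=> /(_ (\sum_(p <- hdec x) << (counit p.2 : k) *g p.1 >>)) []; exists (hdec x) => //.
by split=> [p /hdecP|] //; exact: hdecE.
Qed.

(** The sum of the coefficients with index in [L] is evaluated on the grading map. It serves with
    two choices of [L]: the degrees whose image in H/I contains 1, and [N]. *)
Lemma counit_pred (L : pred G) (s : seq (G * H)) g :
  (forall p, p \in s -> homog p.1 p.2) ->
  grading_map (\sum_(p <- s) p.2) = << g >> - << 1%g >> ->
  \sum_(p <- s | L p.1) (counit p.2 : k) = (L g)%:R - (L 1%g)%:R.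
Proof.
(* [L] may be infinite, but only the finitely many degrees in [u] contribute. *)
move=> sP e; pose u := undup (g :: 1%g :: map fst s).
have uu : uniq u by exact: undup_uniq.
have delta h c : h \in u -> \sum_(m <- u | L m) (c *+ (h == m)) = c *+ L h :> k.
  move=> hu; rewrite big_mkcond (bigD1_seq h) //= eqxx big1 ?addr0 => [|m hm].
    by case: (L h).
  by rewrite eq_sym (negPf hm); case: (L m).
have gu : g \in u by rewrite mem_undup inE eqxx.
have u1 : 1%g \in u by rewrite mem_undup !inE eqxx orbT.
transitivity (\sum_(m <- u | L m) (grading_map (\sum_(p <- s) p.2))@_m).
  under [RHS]eq_bigr => m _ do rewrite grading_mapE hcomp_sum // linear_sum big_mkcond.
  rewrite exchange_big /= big_mkcond; apply: eq_big_seq => p ps.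
  have pu : p.1 \in u by rewrite mem_undup !inE map_f ?orbT.
  transitivity ((counit p.2 : k) *+ L p.1); first by case: (L p.1).
  rewrite -(delta _ _ pu); apply: eq_bigr => m _.
  by case: eqP.
under eq_bigr => m _ do rewrite e mcoeffB !mcoeffU.
by rewrite sumrB !delta.
Qed.

Lemma grading_map_sub1 g (x y : H) : homog g x -> homog 1%g y ->
  counit x = 1 -> counit y = 1 -> grading_map (x - y) = << g >> - << 1%g >>.
Proof.
move=> gx y1 ex ey; apply/malgP => m; rewrite grading_mapE !linearB /=.
rewrite (hcomp_homog _ gx) (hcomp_homog _ y1) mcoeffB !mcoeffU.
by congr (_ - _); case: eqP => _; rewrite ?linear0 ?ex ?ey.
Qed.

End HomogeneousComponents.

(** * Families of subspaces indexed by a group *)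

Record pregraded (k : fieldType) (G : groupType) (R : quasiHopfType k)
    (M : G -> set R) : Prop := Pregraded {
  pg_subspace : forall g, subspace (M g);
  pg1 : M 1%g 1;
  pgM : forall g h x y, M g x -> M h y -> M (g * h)%g (x * y);
  pg_Delta : forall g x, M g x -> tensset (M g) (M g) (Delta x);
  pg_antipode : forall g x, M g x -> M (g^-1)%g (antipode x);
  pg_Phi : tensset (M 1%g) (tensset (M 1%g) (M 1%g)) (Phi : R \ot (R \ot R));
  pg_Phi_inv : tensset (M 1%g) setT (Phi_inv : R \ot (R \ot R));
  pg_alpha : M 1%g alpha;
  pg_beta : M 1%g beta;
  pg_counit : forall g, exists x, M g x /\ counit x = 1;
  pg_total : forall P : R -> Prop, subspace P -> (forall g x, M g x -> P x) ->
    forall x, P x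
}.

Section Pregraded.
Variables (k : fieldType) (G : groupType) (R : quasiHopfType k) (M : G -> set R).
Hypothesis hM : pregraded M.
Implicit Types (g h : G) (x y : R).

Lemma counit_slice (f : {linear R -> k^o}) (t : R \ot R) :
  counit (slice f t) = f (tlift (fun a b => (counit b : k) *: a) t).
Proof.
elim/tensor_ind: t => [|t t' ht ht'|a b].
- by rewrite !(tlift0 (counitr_bilinear _)) !linear0.
- by rewrite (tliftD (counitr_bilinear _)) !linearD /= ht ht'.
- by rewrite sliceE (tliftE (counitr_bilinear _)) !linearZ /= [LHS]mulrC.
Qed.

(** In Sweedler notation, [beta] lies in the product because [d' beta S(d'')] is [counit d] times
    [beta]. The axiom [Phi_antipode] then writes 1 as a sum of multiples of [beta] by neutral
    elements on both sides. *)
Lemma one_prodset g h d : tensset (M g) (M h) (Delta d) -> counit d = 1 ->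
  prodset (M g) (M (h^-1)%g) 1.
Proof.
move=> dM d1; have hP : subspace (prodset (M g) (M (h^-1)%g)) by exact: linspan_subspace.
have bP : prodset (M g) (M (h^-1)%g) beta.
  rewrite -[beta]scale1r -d1 -antipode_beta.
  apply: tlift_tensset dM => //; first exact: antipoder_bilinear.
    by move=> c u v; rewrite -!scalerAl.
  move=> x y gx hy; apply: prodset_in; last exact: (pg_antipode hM).
  by rewrite -[g]mulg1; apply: (pgM hM) => //; exact: (pg_beta hM).
rewrite -[X in prodset _ _ X](@Phi_antipode k R).
apply: tlift_tensset (pg_Phi hM) => //; first exact: antipodem_bilinear.
  move=> c u v; rewrite /tlift scaler_sumr; apply: eq_bigr => p _.
  by rewrite -!scalerAl.
move=> a t ha; apply: tlift_tensset => //; first exact: antipodem_bilinear0.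
  by move=> c u v; rewrite linearZ /= -!scalerAr -!scalerAl.
move=> b c hb hc; rewrite -!mulrA.
set z := antipode b * _; have hz : M 1%g z.
  rewrite -[1%g]mulg1; apply: (pgM hM).
    by rewrite -invg1; exact: (pg_antipode hM).
  by rewrite -[1%g]mulg1; apply: (pgM hM) => //; exact: (pg_alpha hM).
rewrite mulrA.
apply: (linspan_sub (mull_subspace a (mulr_subspace z hP)) _ bP).
move=> _ [x gx [y hy <-]] /=; rewrite [a * _]mulrA -[_ * z]mulrA; apply: prodset_in.
  by rewrite -[g]mul1g; apply: (pgM hM).
by rewrite -[(h^-1)%g]mulg1; apply: (pgM hM).
Qed.

Lemma pg_strong g : exists s : seq (R * R),
  (forall p, p \in s -> M g p.1 /\ M (g^-1)%g p.2) /\ \sum_(p <- s) p.1 * p.2 = 1.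
Proof.
have [d [gd d1]] := pg_counit hM g.
have h := one_prodset (pg_Delta hM gd) d1.
by have [s [sP e]] := prodset_sum (pg_subspace hM g) h; exists s.
Qed.

Lemma pg_prod g h x : prodset (M g) (M h) x -> M (g * h)%g x.
Proof.
apply: linspan_sub; first exact: (pg_subspace hM).
by move=> _ [a ga [b hb <-]]; apply: (pgM hM).
Qed.

(** With [f y = 1], the slice [d] of [Delta y] lies in both components and has counit 1. Its
    coproduct lies in [M g \ot M h] by [tensset_cap], so [one_prodset] applies. *)
Lemma pg_meet g h y : M g y -> M h y -> y != 0 -> M (g * h^-1)%g 1.
Proof.
move=> gy hy y0.
have h0 : subspace [set (0 : R)] by split=> // c x z -> ->; rewrite scaler0 addr0.
have [|f [_ f1]] := @ex_separating_form k R _ y h0; first exact/eqP.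
set d := slice f (Delta y).
have gd : M g d by exact: slice_tensset (pg_subspace hM g) (pg_Delta hM gy).
have hd : M h d by exact: slice_tensset (pg_subspace hM h) (pg_Delta hM hy).
apply: pg_prod; apply: (@one_prodset g h d); last by rewrite counit_slice counit_right.
apply: tensset_cap; first exact: (pg_subspace hM).
- exact: (tenssetS (fun _ => id) (fun _ _ => I) (pg_Delta hM gd)).
- exact: (tenssetS (fun _ _ => I) (fun _ => id) (pg_Delta hM hd)).
Qed.

(** Induction on the length of the relation. A nonzero [y] is outside the component [M g] of the
    first term, by [pg_meet]. Slicing the coproducts with a form that kills [M g] and is 1 at [y]
    removes that term; the new left side has counit 1, yet vanishes by induction. *)
Lemma pg_independent h (s : seq (G * R)) y :
  M h y -> (forall p, p \in s -> M p.1 p.2 /\ ~ M (h * p.1^-1)%g 1) ->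
  y = \sum_(p <- s) p.2 -> y = 0.
Proof.
have [n] := ubnP (size s); elim: n s y => // n IHn [|[g m] s] y /= sn hy sP ye.
  by rewrite ye big_nil.
apply/eqP/negPn/negP => y0.
have [gm hg] := sP (g, m) (mem_head _ _).
have [gy|gy] := pselect (M g y); first by apply: hg; exact: (pg_meet hy gy y0).
have [f [fM f1]] := ex_separating_form (pg_subspace hM g) gy.
have : counit (slice f (Delta y)) = 1 by rewrite counit_slice counit_right.
rewrite (IHn [seq (p.1, slice f (Delta p.2)) | p <- s] (slice f (Delta y))).
- by rewrite linear0 => /esym/eqP; rewrite oner_eq0.
- by rewrite size_map.
- exact: slice_tensset (pg_subspace hM h) (pg_Delta hM hy).
- move=> _ /mapP [p ps ->] /=; have [|pM ph] := sP p; first by rewrite inE ps orbT.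
  by split=> //; apply: slice_tensset (pg_subspace hM _) (pg_Delta hM pM).
- rewrite big_map ye big_cons /= !linearD /= (slice_eq0 fM (pg_Delta hM gm)) add0r.
  by rewrite !linear_sum.
Qed.

Lemma pg_oneV g : M g 1 -> M (g^-1)%g 1.
Proof.
by move=> g1; rewrite -[(g^-1)%g]mul1g; apply: (pg_meet (pg1 hM) g1); exact: oner_neq0.
Qed.

(* S(x) = S(x) S(Phi^(-1)) alpha Phi^(-2) beta S(Phi^(-3)); move S(x) past
   S(Phi^(-1)) and use S(x) alpha = x^{-1} alpha. *)
Lemma grouplike_antipode x y : x * y = 1 -> y * x = 1 -> grouplike x ->
  (forall b, M 1%g b -> x * b = b * x) -> antipode x = y.
Proof.
move=> xy yx [xD x1] xB.
have yB b : M 1%g b -> y * b = b * y.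
  by move=> hb; rewrite -[LHS]mulr1 -xy -!mulrA [b * _]mulrA -xB // !mulrA yx mul1r.
have Sxa : antipode x * alpha = y * alpha.
  have := antipode_alpha x; rewrite xD (tliftE (antipodel_bilinear _ _)) x1 scale1r.
  move=> /(congr1 ( *%R^~ y)); rewrite /= -[_ * x * y]mulrA xy mulr1 => ->.
  by rewrite yB //; exact: (pg_alpha hM).
pose Z := [set z | antipode x * z = y * z]; have hZ : subspace Z.
  split=> [|c z w hz hw]; rewrite /Z /=; first by rewrite !mulr0.
  by rewrite !mulrDr -!scalerAr hz hw.
suff : Z 1 by rewrite /Z /= !mulr1.
rewrite -[X in Z X](@Phi_inv_antipode k R).
apply: tlift_tensset (pg_Phi_inv hM) => //; first exact: antipodeo_bilinear.
  move=> c u v; rewrite /tlift scaler_sumr; apply: eq_bigr => p _.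
  by rewrite linearZ /= -!scalerAl.
move=> a t ha _; apply: tlift_tensset (tenssetT t) => //; first exact: antipodeo_bilinear0.
  by move=> c u v; rewrite -!scalerAr -!scalerAl.
move=> b c _ _; rewrite /Z /= !mulrA -antipodeM -xB // antipodeM.
rewrite -[antipode a * _ * _]mulrA Sxa mulrA -yB //.
by rewrite -invg1; exact: (pg_antipode hM).
Qed.

End Pregraded.

(** * Quasi-Hopf ideals with given support and neutral component *)

Section NormalSubgroupTheory.
Variables (G : groupType) (N : normalSubgroup G).
Implicit Types g h : G.

Lemma nsgM g h : g \in N -> h \in N -> (g * h)%g \in N.
Proof. exact: group_closedM (nsg_closed N) g h. Qed.

Lemma nsgV g : (g^-1)%g \in N = (g \in N).
Proof.
have h := group_closedV (nsg_closed N).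
by apply/idP/idP => [/h|/h //]; rewrite invgK.
Qed.

Lemma nsgMl g h : g \in N -> (g * h)%g \in N = (h \in N).
Proof.
move=> gN; apply/idP/idP => [ghN|]; last exact: nsgM.
by rewrite -[h](mulKg g); apply: nsgM => //; rewrite nsgV.
Qed.

Lemma nsgMC g h : (g * h)%g \in N = ((h * g)%g \in N).
Proof.
suff H a b : (a * b)%g \in N -> (b * a)%g \in N by apply/idP/idP; exact: H.
by move=> /(nsg_normal (a^-1)%g); rewrite mulKg invgK.
Qed.

Lemma val_nsgM (n m : N) : val (n * m)%g = (val n * val m)%g.
Proof. by []. Qed.

Lemma val_nsgV (n : N) : val (n^-1)%g = ((val n)^-1)%g.
Proof. exact: gmulfV. Qed.

Lemma val_nsg_conj g (n : N) : val (nsg_conj g n) = (g * val n * g^-1)%g.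
Proof. by []. Qed.

End NormalSubgroupTheory.

Lemma pregraded_homog (k : fieldType) (G : groupType) (H : gradedQuasiHopf k G) :
  faithfully_graded H -> pregraded (@homog k G H).
Proof.
move=> Hf; have hH := gqhP H.
split; try by case: hH.
- exact: homog1.
- exact: graded_Phi_inv.
- move=> g; have [x gx x0] := Hf g.
  have [[y [gy y0]]|h] := pselect (exists y : H, homog g y /\ counit y != 0 :> k).
    exists ((counit y : k)^-1 *: y); split; first exact: subspaceZ (homog_subspace _ g) gy.
    by rewrite linearZ /=; exact: mulVf.
  (* If the counit vanished on the component, slicing [Delta x] with it would give [x = 0]. *)
  case/eqP: x0; rewrite -(counit_left x).
  apply: (slice_eq0 _ (graded_Delta hH gx)) => y gy.
  by apply: contrapT => /eqP y0; apply: h; exists y.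
- exact: homog_ind.
Qed.

Lemma pregraded_qhproj (k : fieldType) (G : groupType) (R : quasiHopfType k)
    (M : G -> set R) (I : qhIdeal R) :
  pregraded M -> pregraded (fun g => @qhproj k R I @` M g).
Proof.
move=> hM; split.
- by move=> g; apply: subspace_image; exact: (pg_subspace hM).
- by exists 1; [exact: (pg1 hM) | exact: rmorph1].
- move=> g h _ _ [x gx <-] [y hy <-]; exists (x * y); last exact: qhprojM.
  exact: (pgM hM).
- move=> g _ [x gx <-]; rewrite [Delta _]qhquot_DeltaE.
  by apply: tensset_tmap (pg_Delta hM gx) => y gy; exists y.
- move=> g _ [x gx <-]; rewrite [antipode _]qhquot_antipodeE.
  by exists (antipode x) => //; exact: (pg_antipode hM).
- apply: tensset_tmap (pg_Phi hM) => [y gy|t]; first by exists y.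
  by apply: tensset_tmap => y gy; exists y.
- by apply: tensset_tmap (pg_Phi_inv hM) => [y gy|//]; exists y.
- by exists alpha => //; exact: (pg_alpha hM).
- by exists beta => //; exact: (pg_beta hM).
- move=> g; have [x [gx x1]] := pg_counit hM g.
  by exists (qhproj I x); split; [exists x | rewrite [counit _]qhquot_counitE].
- move=> P hP PM; elim/qhprojW.
  apply: (pg_total hM); first exact: (subspace_preim (qhproj I) hP).
  by move=> g x gx; apply: (PM g); exists x.
Qed.

Section IdealOver.
Variables (k : fieldType) (G : groupType) (H : gradedQuasiHopf k G).
Hypothesis H_faithful : faithfully_graded H.
Variables (N : normalSubgroup G) (J : invIdeal H) (I : set H).
Hypothesis hI : ideal_over N J I.

Let hqh : is_qhideal setT I. Proof. by case: hI. Qed.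
Let hM := pregraded_homog H_faithful.
Local Notation p := (@qhproj k H (QHIdeal hqh)).
Let hpM := pregraded_qhproj (QHIdeal hqh) hM.
Let Isub : subspace I. Proof. exact: qhi_subspace hqh. Qed.

Lemma over_lift_set : lift_set J `<=` I.
Proof.
apply: linspan_sub => // _ [h _ [j Jj <-]].
apply: (qhi_mull hqh) => //; case: hI => _ _ IJ.
by move: Jj; rewrite -IJ => -[].
Qed.

(** By strongness [x] is a sum of terms [a * (b * x)] with [a] of degree [g] and [b] of degree
    [g^-1]; each [b * x] is neutral and in [I], hence in [J]. *)
Lemma over_homog g x : homog g x -> I x -> lift_set J x.
Proof.
move=> gx Ix; have [s [sP s1]] := pg_strong hM g.
have Jsub : subspace (lift_set J) by exact: linspan_subspace.
rewrite -[x]mul1r -s1 mulr_suml; apply: subspace_sum => // r /sP [r1 r2] _.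
rewrite -mulrA; apply: prodset_in => //; case: hI => _ _ <-; split.
  exact: (qhi_mull hqh).
by rewrite -(mulVg g); apply: (pgM hM).
Qed.

Lemma over_one n : (p @` homog n) 1 <-> n \in N.
Proof.
split=> [[x nx /qhprojP xI]|nN].
  have : ideal_support I n.
    exists (x - 1) => //; apply: grading_map_sub1 => //; first exact: homog1.
      have := qhi_counit hqh xI; rewrite linearB /= rmorph1 => /subr0_eq ->.
      by [].
    exact: rmorph1.
  by case: hI => _ ->.
have [x Ix xn] : ideal_support I n by case: hI => _ ->.
(* The part [y] of [x] with degrees in [L] has its image in that of the neutral component. Modulo
   [I] it is the opposite of the remaining terms, so it vanishes by independence and its counit is
   0. By [counit_pred] this counit is also [L n - 1], whence [L n]. *)
pose L g := `[< (p @` homog g) 1 >].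
pose y := \sum_(r <- hdec x | L r.1) r.2.
have y0 : p y = 0.
  apply: (pg_independent hpM (h := 1%g)
    (s := [seq (r.1, p (- r.2)) | r <- [seq r <- hdec x | ~~ L r.1]])).
  - rewrite /y linear_sum; apply: (subspace_sum (pg_subspace hpM _)) => r /hdecP rP.
    move=> /asboolP /(pg_oneV hpM) r1; rewrite /= -[qhproj _ _]mulr1 -(mulgV r.1).
    by apply: (pgM hpM) => //; exists r.2.
  - move=> _ /mapP [r + ->]; rewrite mem_filter => /andP[/asboolP rL /hdecP rP].
    split; first by exists (- r.2) => //; exact: subspaceN (homog_subspace _ _) rP.
    by rewrite /= mul1g => /(pg_oneV hpM); rewrite invgK.
  - rewrite big_map big_filter -linear_sum sumrN /=; apply/qhprojP.
    by rewrite opprK /y -(bigID (fun r => L r.1) xpredT) -hdecE.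
have : counit y = 0 by apply: (qhi_counit hqh); exact: (qhproj_eq0 (QHIdeal hqh) y).1.
have -> : counit y = \sum_(r <- hdec x | L r.1) (counit r.2 : k) :> k.
  exact: linear_sum.
rewrite (counit_pred L (g := n)); last by rewrite -hdecE.
  have -> : L 1%g by apply/asboolP; exact: (pg1 hpM).
  case: (asboolP _ : reflect _ (L n)) => // _ /eqP.
  by rewrite sub0r oppr_eq0 oner_eq0.
by move=> r /hdecP.
Qed.

Lemma over_split n x : n \in N -> homog n x -> exists2 b, homog 1%g b & I (x - b).
Proof.
move=> /over_one /(pg_oneV hpM) n1 nx.
have : (p @` homog (n * n^-1)%g) (p x * 1) by apply: (pgM hpM) => //; exists x.
by rewrite mulgV mulr1 => -[b b1 /esym/qhprojP bI]; exists b.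
Qed.

Lemma over_independent g y (s : seq (G * H)) :
  homog g y -> (forall r, r \in s -> homog r.1 r.2 /\ (g * r.1^-1)%g \notin N) ->
  I (y + \sum_(r <- s) r.2) -> I y.
Proof.
move=> gy sP yI; apply/(qhproj_eq0 (QHIdeal hqh)).
apply: (pg_independent hpM (h := g) (s := [seq (r.1, p (- r.2)) | r <- s])).
- by exists y.
- move=> _ /mapP [r /sP [rP rN] ->] /=; split; last by move/over_one; apply/negP.
  by exists (- r.2) => //; exact: subspaceN (homog_subspace _ _) rP.
- by rewrite big_map -linear_sum sumrN; apply/qhprojP; rewrite opprK.
Qed.

End IdealOver.

(** * Retractions *)

Section LiftedQuotientTheory.
Variables (k : fieldType) (G : groupType) (H : gradedQuasiHopf k G).
Hypothesis H_faithful : faithfully_graded H.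
Variables (N : normalSubgroup G) (J : invIdeal H).

Local Notation Q := (lifted_quot J).
Local Notation q := (@qhproj k H (lift_ideal J)).
Local Notation Qh := (@quot_homog k G H J).
Local Notation A := (quot_sub N J).

Let hH := pregraded_homog H_faithful.

Lemma pregraded_quot : pregraded Qh.
Proof. exact: pregraded_qhproj (lift_ideal J) hH. Qed.

Let hQ := pregraded_quot.

Lemma qproj_eq0 x : q x = 0 <-> lift_set J x.
Proof. exact: (qhproj_eq0 (lift_ideal J)). Qed.

(** Together with [quot_conj_comm], this trades the decomposition of 1 chosen in [quot_conj] for the
    relation [h * x = y * h] with [h] of degree [g]. *)
Lemma quot_conj_eq g x y :
  (forall h, Qh g h -> h * x = y * h) -> quot_conj g x = y.
Proof.
move=> hxy; rewrite /quot_conj.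
have sumE s : (forall p : Q * Q, p \in s -> Qh g p.1 /\ Qh (g^-1)%g p.2) ->
    \sum_(p <- s) p.1 * p.2 = 1 -> \sum_(p <- s) p.1 * x * p.2 = y.
  move=> sP s1; rewrite -[RHS]mulr1 -s1 mulr_sumr; apply: eq_big_seq => p /sP [p1 _].
  by rewrite hxy // mulrA.
case: xgetP => [_ _ [s [sP s1 ->]]|]; first exact: sumE.
have [s [sP s1]] := pg_strong hQ g.
by move=> /(_ y) []; exists s; split=> //; rewrite sumE.
Qed.

Lemma quot_conj_comm g x h : (forall b, Qh 1%g b -> x * b = b * x) -> Qh g h ->
  h * x = quot_conj g x * h.
Proof.
move=> xB gh; rewrite /quot_conj.
case: xgetP => [_ _ [s [sP s1 ->]]|].
  rewrite mulr_suml -[h in LHS]mul1r -s1 !mulr_suml; apply: eq_big_seq => p /sP [_ p2].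
  have ph : Qh 1%g (p.2 * h) by rewrite -(mulVg g); apply: (pgM hQ).
  by rewrite -!mulrA [p.2 * _]mulrA -xB // !mulrA.
have [s [sP s1]] := pg_strong hQ g.
by move=> /(_ (\sum_(p <- s) p.1 * x * p.2)) []; exists s.
Qed.

Lemma quot_sub_subspace : subspace A.
Proof. exact/subspace_image/linspan_subspace. Qed.

Lemma quot_homog_sub (n : N) : Qh (val n) `<=` A.
Proof. by move=> _ [x nx <-]; exists x => //; apply: linspan_in; exists n. Qed.

Lemma quot_neutral_sub : Qh 1%g `<=` A.
Proof. exact: (@quot_homog_sub 1%g). Qed.

Lemma quot_sub_ind (P : set Q) : subspace P ->
  (forall n : N, Qh (val n) `<=` P) -> A `<=` P.
Proof.
move=> hP QP _ [x xN <-]; apply: linspan_image xN => // y [n ny].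
by apply: (QP n); exists y.
Qed.

Lemma quot_sub_Delta x : A x -> tensset A A (Delta x).
Proof.
move: x; apply: quot_sub_ind.
  exact: (subspace_preim (Delta : {linear Q -> (Q \ot Q)%type}) (tensset_subspace A A)).
move=> n x nx; have AQ := @quot_homog_sub n.
exact: (tenssetS AQ AQ (pg_Delta hQ nx)).
Qed.

Lemma grouplike_splitting1 (u : N -> Q) : grouplike_splitting u -> u 1%g = 1.
Proof.
move=> hu; have [y _ [uy yu]] := gls_unit hu 1%g.
by rewrite -[LHS]mul1r -yu -mulrA (gls_mul hu) mulg1.
Qed.

Lemma equivariant_conj (u : N -> Q) g h n : equivariant_family N J u ->
  Qh g h -> h * u n = u (nsg_conj g n) * h.
Proof.
by move=> [hu uc] gh; rewrite -uc; apply: quot_conj_comm => // b /(gls_comm hu).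
Qed.

Section Retraction.
Variable I : set H.
Hypothesis hI : ideal_over N J I.

Let hqh : is_qhideal setT I. Proof. by case: hI. Qed.
Let Isub : subspace I. Proof. exact: qhi_subspace hqh. Qed.
Local Notation qI := (q @` I).

Lemma over_image x : qI (q x) <-> I x.
Proof.
split=> [[y Iy /qhprojP yx]|Ix]; last by exists x.
by rewrite -[x](subKr y); apply: subspaceB => //; apply: (over_lift_set hI).
Qed.

Lemma over_image_subspace : subspace qI.
Proof. exact: subspace_image. Qed.

Lemma over_image_mull x y : qI y -> qI (x * y).
Proof.
elim/qhprojW: x => x; elim/qhprojW: y => y; rewrite -qhprojM !over_image.
exact: (qhi_mull hqh).
Qed.

Lemma over_image_mulr x y : qI x -> qI (x * y).
Proof.
elim/qhprojW: x => x; elim/qhprojW: y => y; rewrite -qhprojM !over_image.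
exact: (qhi_mulr hqh).
Qed.

Lemma over_image_homog g x : Qh g x -> qI x -> x = 0.
Proof. by move=> [y gy <-] /over_image /(over_homog H_faithful hI gy) /qproj_eq0. Qed.

Lemma over_quot_split x : A x -> exists b, Qh 1%g b /\ qI (x - b).
Proof.
move: x; apply: quot_sub_ind => [|n _ [x nx <-]].
  split; first by exists 0; split; [case: (pg_subspace hQ 1%g)|rewrite subr0; case: over_image_subspace].
  move=> c x y [b [b1 xb]] [b' [b1' yb']]; exists (c *: b + b'); split.
    by apply: (pg_subspace hQ 1%g).2.
  by rewrite opprD addrACA -scalerBr; apply: over_image_subspace.2.
have [b b1 bI] := over_split H_faithful hI (valP n) nx.
by exists (q b); split; [exists b | rewrite -linearB; apply/over_image].
Qed.

Definition is_projector (P : Q -> Q) : Prop :=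
  [/\ forall x, Qh 1%g (P x), forall x, Qh 1%g x -> P x = x & forall x, qI x -> P x = 0].

(** The neutral component and the image of [I] meet trivially but need not span [Q]. Their sum
    contains [quot_sub N J]; outside that sum the values of [P] depend on a choice of complement. *)
Lemma over_projector : exists P : {linear Q -> Q}, is_projector P.
Proof.
apply: ex_projector; [exact: pg_subspace hQ 1%g | exact: over_image_subspace |].
exact: over_image_homog.
Qed.

Section Projector.
Variable P : {linear Q -> Q}.
Hypothesis hP : is_projector P.

Lemma projectorE x b : Qh 1%g b -> qI (x - b) -> P x = b.
Proof.
case: hP => _ P1 PI hb xb; rewrite -[x](subrK b) linearD /= PI // add0r.
exact: P1.
Qed.

(** Split [x] into a neutral [b] and an element of the image of [I]: [P \ot P] fixes [Delta b] and
    kills the coproduct of the other part. *)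
Lemma projector_Delta x : A x -> Delta (P x) = tmap P P (Delta x).
Proof.
case: hP => _ P1 PI /over_quot_split [b [b1 xb]]; rewrite (projectorE b1 xb).
rewrite -[x](subrK b) linearD linearD /= (tmap_id P1 P1 (pg_Delta hQ b1)).
rewrite (@tmap_eq0 _ _ _ _ _ P P qI qI) ?add0r //.
case: xb => i Ii <-; rewrite [Delta _]qhquot_DeltaE.
have := qhi_Delta hqh Ii; apply: linspan_image; first exact: linspan_subspace.
move=> t [] h; apply: linspan_in; [left|right]; apply: tensset_tmap h => // y Iy.
- by exists y.
- by exists y.
Qed.

Lemma projector_retraction : retraction_of N J I P.
Proof.
have [PQ P1 PI] := hP; have Asub := quot_sub_subspace.
have A1 := quot_neutral_sub; have Ksub := over_image_subspace.
split=> // [|x Ax]; last first.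
  split=> [Px0|[i [Ii Ni] <-]]; last by apply: PI; exists i.
  have [b [b1 xb]] := over_quot_split Ax; have b0 := projectorE b1 xb.
  move: xb; rewrite -b0 Px0 subr0 => -[i Ii ix].
  case: Ax ix => y yN <- /esym /qhprojP yi; exists y => //; split=> //.
  by rewrite -[y](subrK i); apply: subspaceD => //; exact: (over_lift_set hI).
split.
- by move=> x _; exact: PQ.
- by move=> c x y _ _; rewrite linearP.
- exact/P1/(pg1 hQ).
- move=> x y /over_quot_split [b [b1 xb]] /over_quot_split [c [c1 yc]].
  rewrite (projectorE b1 xb) (projectorE c1 yc); apply: projectorE.
    by rewrite -[1%g]mulg1; apply: (pgM hQ).
  have -> : x * y - b * c = (x - b) * y + b * (y - c).
    by rewrite mulrBl mulrBr addrA subrK.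
  by apply: subspaceD => //; [apply: over_image_mulr|apply: over_image_mull].
- move=> x Ax; have [s [sA sx]] := tensset_sum Asub (quot_sub_Delta Ax).
  exists s; split=> //; rewrite projector_Delta // sx linear_sum /=.
  by apply: eq_bigr => p _; rewrite tmapE.
- move=> x /over_quot_split [b [b1 xb]]; rewrite (projectorE b1 xb).
  apply/eqP; rewrite eq_sym -subr_eq0 -linearB; apply/eqP.
  case: xb => i Ii <-; apply: etrans (qhquot_counitE (lift_ideal J) i) _.
  exact: (qhi_counit hqh).
- have Q1 := pg_subspace hQ 1%g.
  have [s [sP e]] := tensset3_sum Q1 Q1 (pg_Phi hQ).
  exists s; split=> // [p /sP [p1 p2 p3]|]; first by split; apply: A1.
  by rewrite e; apply: eq_big_seq => p /sP [p1 p2 p3]; rewrite !P1.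
- move=> x /over_quot_split [b [b1 xb]]; rewrite (projectorE b1 xb).
  apply: projectorE; first by rewrite -invg1; exact: (pg_antipode hQ).
  rewrite -linearB; case: xb => i Ii <-; rewrite [antipode _]qhquot_antipodeE.
  by apply/over_image; exact: (qhi_antipode hqh).
- exact/P1/(pg_alpha hQ).
- exact/P1/(pg_beta hQ).
Qed.

End Projector.

Lemma retractionB tau x y : retraction_of N J I tau -> A x -> A y ->
  tau (x - y) = tau x - tau y.
Proof.
case=> -[_ taul _ _ _ _ _ _ _ _] _ _ Ax Ay.
by rewrite addrC -scaleN1r taul // scaleN1r addrC.
Qed.

Lemma retraction_sub_eq0 tau x : retraction_of N J I tau -> A x ->
  A (x - tau x) /\ tau (x - tau x) = 0.
Proof.
move=> htau Ax; have [[tauA _ _ _ _ _ _ _ _ _] tau1 _] := htau.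
have At : A (tau x) by apply: quot_neutral_sub; exact: tauA.
split; first by apply: subspaceB => //; exact: quot_sub_subspace.
by rewrite (retractionB htau) // (tau1 (tau x)) ?subrr //; exact: tauA.
Qed.

Lemma retraction_sub_ker tau x : retraction_of N J I tau -> A x -> qI (x - tau x).
Proof.
move=> htau Ax; have [Axt xt0] := retraction_sub_eq0 htau Ax.
have [_ _ taui] := htau.
by have [i [Ii _] ix] := (taui _ Axt).1 xt0; exists i.
Qed.

(** [x - tau x] is in the common kernel, and [tau'] fixes the neutral element [tau x]. *)
Lemma retraction_unique tau tau' x : retraction_of N J I tau ->
  retraction_of N J I tau' -> A x -> tau' x = tau x.
Proof.
move=> htau htau' Ax; have [Axt xt0] := retraction_sub_eq0 htau Ax.
have [[tauA _ _ _ _ _ _ _ _ _] _ taui] := htau; have [_ tau1' taui'] := htau'.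
have At : A (tau x) by apply: quot_neutral_sub; exact: tauA.
move: xt0 => /(taui _ Axt)/(taui' _ Axt); rewrite (retractionB htau') //.
by move=> /subr0_eq ->; apply: tau1'; exact: tauA.
Qed.

End Retraction.

End LiftedQuotientTheory.

(** * The ideal of a character datum *)

Section DatumIdeal.
Variables (k : fieldType) (G : groupType) (H : gradedQuasiHopf k G).
Hypothesis H_faithful : faithfully_graded H.
Variables (N : normalSubgroup G) (J : invIdeal H).

Local Notation Q := (lifted_quot J).
Local Notation q := (@qhproj k H (lift_ideal J)).
Local Notation Qh := (@quot_homog k G H J).
Local Notation A := (quot_sub N J).

Let hH := pregraded_homog H_faithful.
Let hQ := pregraded_quot H_faithful J.

(** * From a quasi-Hopf ideal to its character datum *)

Section RetractionDatum.
Variables (u : N -> Q) (I : set H).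
Hypothesis u_family : equivariant_family N J u.
Hypothesis hI : ideal_over N J I.

Let hu : grouplike_splitting u. Proof. by case: u_family. Qed.
Let Au n : A (u n). Proof. exact: quot_homog_sub (gls_degree hu n). Qed.

Lemma projector_datum (P : {linear Q -> Q}) :
  is_projector I P -> character_datum N J (P \o u).
Proof.
move=> hP; have hr := projector_retraction H_faithful hI hP.
have [PQ P1 PI] := hP; have [[_ _ Pone PM _ _ _ _ _ _] _ _] := hr.
have Puu n m : P (u n) * P (u m) = P (u (n * m)%g) by rewrite -PM // (gls_mul hu).
have PB n b : Qh 1%g b -> P (u n) * b = b * P (u n).
  move=> hb; have Ab := quot_neutral_sub N hb.
  by rewrite -{1}(P1 b hb) -PM // (gls_comm hu) // PM // P1.
have uP n : (q @` I) (u n - P (u n)).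
  have [b [b1 ub]] := over_quot_split H_faithful hI (Au n).
  by rewrite (projectorE hP b1 ub).
split; first by exists u.
- move=> n; split=> //; first exact: PQ.
  + exists (P (u (n^-1)%g)); first exact: PQ.
    by rewrite !Puu mulgV mulVg (grouplike_splitting1 hu).
  + by move=> b; exact: PB.
  + have [uD u1] := gls_grouplike hu n; split.
      by rewrite (projector_Delta H_faithful hI hP) // uD tmapE.
    by rewrite -u1; have [[_ _ _ _ _ + _ _ _ _] _ _] := hr; apply; exact: Au.
- by move=> n m; rewrite /= Puu.
(* The defect of the conjugation relation has degree [g]. It also lies in the image of [I], since
   [u] satisfies the relation and [P] changes [u] only by elements of that image; such a homogeneous
   element is zero. *)
- move=> g n; apply: (quot_conj_eq H_faithful) => h gh; rewrite /=.
  set n' := nsg_conj g n; apply/subr0_eq.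
  apply: (over_image_homog H_faithful hI (g := g)).
    apply: subspaceB; first exact: (pg_subspace hQ).
      by rewrite -[g]mulg1; apply: (pgM hQ).
    by rewrite -[g]mul1g; apply: (pgM hQ).
  have -> : h * P (u n) - P (u n') * h = (u n' - P (u n')) * h - h * (u n - P (u n)).
    rewrite mulrBl mulrBr (equivariant_conj H_faithful _ u_family gh) opprB.
    by rewrite addrACA [u n' * h + _]addrC addrACA subrr addr0.
  apply: subspaceB; first exact: (over_image_subspace hI).
    exact: (over_image_mulr hI).
  exact: (over_image_mull hI).
Qed.

Lemma retraction_datum tau : retraction_of N J I tau -> character_datum N J (tau \o u).
Proof.
move=> htau; have [P hP] := over_projector H_faithful hI.
have -> : tau \o u = P \o u; last exact: projector_datum.
apply/funext => n /=; have hPr := projector_retraction H_faithful hI hP.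
exact: (retraction_unique hPr htau (Au n)).
Qed.

End RetractionDatum.

(** * Reduction modulo the ideal of a datum *)

Section Lifts.
Variables (u gamma : N -> Q) (ut gt : N -> H).
Hypothesis u_family : equivariant_family N J u.
Hypothesis ut_lift : forall n, is_lift J (val n) (u n) (ut n).
Hypothesis gamma_datum : character_datum N J gamma.
Hypothesis gt_lift : forall n, is_lift J 1%g (gamma n) (gt n).

Let hu : grouplike_splitting u. Proof. by case: u_family. Qed.
Local Notation D := (datum_ideal N J ut gt).

Lemma q_ut n : q (ut n) = u n. Proof. by case: (ut_lift n). Qed.
Lemma q_gt n : q (gt n) = gamma n. Proof. by case: (gt_lift n). Qed.

Lemma lift_set_datum : lift_set J `<=` D.
Proof. by move=> x Jx; apply: ideal_gen_in; left. Qed.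

Lemma datum_gen n : D (ut n - gt n).
Proof. by apply: ideal_gen_in; right; exists n. Qed.

(** [ut n] and [gt n] agree modulo the ideal, so for a lift [c] of the inverse of [gamma n], right
    multiplication by [c * ut n] is the identity there. This moves a term to any other degree in its
    coset of [N]. *)
Lemma datum_shift g (n : N) y : homog g y ->
  exists2 y', homog (g * val n)%g y' & D (y - y').
Proof.
move=> gy; have [_ [_ [c c1 <-] [gc cg]] _ _] := cd_grouplike gamma_datum n.
have Dsub : subspace D by exact: ideal_gen_subspace.
exists (y * c * ut n).
  apply: (pgM hH); last by case: (ut_lift n).
  by rewrite -[g]mulg1; apply: (pgM hH).
have -> : y - y * c * ut n = y * c * (gt n - ut n) + y * (1 - c * gt n).
  by rewrite !mulrBr mulr1 !mulrA [RHS]addrC addrA subrK.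
apply: subspaceD => //; apply: ideal_gen_mull.
  by rewrite -opprB; apply: subspaceN => //; exact: datum_gen.
apply: lift_set_datum; apply/qproj_eq0.
by rewrite linearB /= qhprojM q_gt [X in _ - X]cg subrr.
Qed.

Lemma ideal_over_sub_datum I : ideal_over N J I -> D `<=` I -> I `<=` D.
Proof.
move=> hI DI x Ix; have [hqh _ _] := hI; have Isub := qhi_subspace hqh.
have Dsub : subspace D by exact: ideal_gen_subspace.
have : forall s, (forall p, p \in s -> homog p.1 p.2) ->
    I (\sum_(p <- s) p.2) -> D (\sum_(p <- s) p.2); last first.
  by move=> /(_ (hdec x)); rewrite -hdecE; apply=> // p /hdecP.
move=> s; have [m] := ubnP (size s); elim: m s => // m IHm [|[g y] s] /= sm sP.
  by rewrite big_nil; case: Dsub.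
rewrite big_cons /= => sI; have /= gy := sP (g, y) (mem_head _ _).
have sP' p : p \in s -> homog p.1 p.2 by move=> ps; apply: sP; rewrite inE ps orbT.
have [/hasP [r rs rN]|/hasPn sN] := boolP (has (fun r => (g * r.1^-1)%g \in N) s).
  (* [y] is moved to the degree of [r] and merged with it, which saves one term. *)
  have rN' : (g^-1 * r.1)%g \in N by rewrite -nsgV invgM invgK nsgMC.
  have [y'] := datum_shift (Sub (g^-1 * r.1)%g rN' : nsg_sort N) gy.
  rewrite SubK mulVKg => y'r yD.
  have e : y + \sum_(p <- s) p.2 =
      (y - y') + \sum_(p <- (r.1, y' + r.2) :: rem r s) p.2.
    by rewrite big_cons /= (perm_big _ (perm_to_rem rs)) big_cons !addrA subrK.
  rewrite e; apply: subspaceD => //; apply: IHm.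
  - by rewrite /= size_rem // prednK // -has_predT; apply/hasP; exists r.
  - move=> p; rewrite inE => /orP[/eqP -> /=|/mem_rem /sP' //].
    by apply: subspaceD (homog_subspace _ _) _ _ => //; exact: sP'.
  - by move/(subspaceB Isub)/(_ (DI _ yD)): sI; rewrite e addrAC subrr add0r.
(* No other term has its degree in the coset of [g], so independence puts [y] itself in [I], hence
   in J^G. *)
have yI : I y.
  apply: (over_independent H_faithful hI gy _ sI) => p ps.
  by split; [apply: sP' | apply: sN].
apply: subspaceD => //; first exact/lift_set_datum/(over_homog H_faithful hI gy).
apply: IHm => //; rewrite -[\sum_(p <- s) p.2](addKr y) addrC.
exact: subspaceB.
Qed.

(** The generator [ut n - gt n] maps into the kernel of [tau], and [tau] fixes [gamma n]. *)
Lemma retraction_gamma tau : retraction_of N J D tau -> tau \o u = gamma.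
Proof.
move=> htau; have [htm tau1 taui] := htau; apply/funext => n /=.
have [gn _ _ _] := cd_grouplike gamma_datum n.
have An : A (u n) by exact: quot_homog_sub (gls_degree hu n).
have Ag : A (gamma n) by exact: quot_neutral_sub.
rewrite -(tau1 _ gn); apply/subr0_eq; rewrite -(retractionB htau) //.
apply/taui; first by apply: subspaceB => //; exact: quot_sub_subspace.
exists (ut n - gt n); last by rewrite -[LHS]/(q _) linearB /= q_ut q_gt.
split; first exact: datum_gen.
apply: subspaceB; first exact: linspan_subspace.
  by apply: linspan_in; exists n; case: (ut_lift n).
by apply: linspan_in; exists 1%g; case: (gt_lift n).
Qed.

End Lifts.

End DatumIdeal.

(** * The ideal of a datum is a quasi-Hopf ideal with support [N] and neutral part [J] *)

Section DatumIdealOver.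
Variables (k : fieldType) (G : groupType) (H : gradedQuasiHopf k G).
Hypothesis H_faithful : faithfully_graded H.
Variables (N : normalSubgroup G) (J : invIdeal H).

Local Notation Q := (lifted_quot J).
Local Notation q := (@qhproj k H (lift_ideal J)).
Local Notation Qh := (@quot_homog k G H J).
Local Notation A := (quot_sub N J).

Let hH := pregraded_homog H_faithful.
Let hQ := pregraded_quot H_faithful J.

Variables (u gamma : N -> Q) (ut gt : N -> H).
Hypothesis u_family : equivariant_family N J u.
Hypothesis ut_lift : forall n, is_lift J (val n) (u n) (ut n).
Hypothesis gamma_datum : character_datum N J gamma.
Hypothesis gt_lift : forall n, is_lift J 1%g (gamma n) (gt n).

Let hu : grouplike_splitting u. Proof. by case: u_family. Qed.
Local Notation D := (datum_ideal N J ut gt).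
Let Dsub : subspace D. Proof. exact: ideal_gen_subspace. Qed.

Lemma gamma1 : gamma 1%g = 1.
Proof.
have [_ [c c1 [gc cg]] _ _] := cd_grouplike gamma_datum 1%g.
by rewrite -[LHS]mul1r -cg -mulrA -(cd_mul gamma_datum) mulg1.
Qed.

Lemma gamma_comm n b : Qh 1%g b -> gamma n * b = b * gamma n.
Proof. by case: (cd_grouplike gamma_datum n) => _ _ + _; apply. Qed.

Lemma gamma_conj g h n : Qh g h -> h * gamma n = gamma (nsg_conj g n) * h.
Proof.
move=> gh; rewrite -(cd_equivariant gamma_datum).
by apply: (quot_conj_comm H_faithful) => // b; exact: gamma_comm.
Qed.

(* The v_n = gamma(n)^{-1} u_n form another equivariant family, and I_gamma is
   generated modulo J^G by the v_n - 1. *)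
Definition twisted_unit (n : N) : Q := gamma (n^-1)%g * u n.
Local Notation v := twisted_unit.

(** [u n] commutes with the neutral element [gamma (m^-1)], and centrality of the values of [gamma]
    restores the order reversed by inversion. *)
Lemma twisted_unitM n m : v n * v m = v (n * m)%g.
Proof.
have [Bn _ _ _] := cd_grouplike gamma_datum (n^-1)%g.
have [Bm _ _ _] := cd_grouplike gamma_datum (m^-1)%g.
rewrite /twisted_unit -!mulrA [u n * _]mulrA (gls_comm hu) // -mulrA (gls_mul hu).
by rewrite mulrA gamma_comm // -(cd_mul gamma_datum) invgM.
Qed.

Lemma twisted_unit_conj g h n : Qh g h -> h * v n = v (nsg_conj g n) * h.
Proof.
move=> gh; rewrite /twisted_unit mulrA (gamma_conj _ gh) -mulrA.
rewrite (equivariant_conj H_faithful _ u_family gh) mulrA; congr (gamma _ * _ * _).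
by apply: val_inj; rewrite !(val_nsgV, val_nsg_conj) !invgM invgK mulgA.
Qed.

Lemma gamma_twisted n : u n = gamma n * v n.
Proof. by rewrite /twisted_unit mulrA -(cd_mul gamma_datum) mulgV gamma1 mul1r. Qed.

Definition twisted_ext (g : G) : Q := if insub g is Some n then v n else 0.

Lemma twisted_extE (n : N) : twisted_ext (val n) = v n.
Proof. by rewrite /twisted_ext valK. Qed.

Lemma twisted_ext0 g : g \notin N -> twisted_ext g = 0.
Proof. by rewrite /twisted_ext => gN; rewrite insubN. Qed.

Lemma twisted_extM (n : N) g : v n * twisted_ext g = twisted_ext (val n * g)%g.
Proof.
have [gN|gN] := boolP (g \in N); last first.
  by rewrite !twisted_ext0 ?mulr0 // nsgMl //; exact: valP.
rewrite -[g]/(val (Sub g gN : nsg_sort N)) twisted_extE twisted_unitM.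
by rewrite -val_nsgM twisted_extE.
Qed.

(* Multiplies the part of degree m in N by v_{m^{-1}}, so as to kill v_n - 1. *)
Definition untwist : H -> Q := hsum (fun g x => q x * twisted_ext (g^-1)%g).

Arguments untwist : simpl never.

Let untwist_part_linear g : linear (fun x : H => q x * twisted_ext (g^-1)%g).
Proof. by move=> c x y; rewrite linearP mulrDl -scalerAl. Qed.

Lemma untwist_is_linear : linear untwist.
Proof. exact: hsum_linear untwist_part_linear. Qed.

HB.instance Definition _ := GRing.isLinear.Build k H Q _ untwist untwist_is_linear.

Lemma untwist_homog g x : homog g x -> untwist x = q x * twisted_ext (g^-1)%g.
Proof. exact: (hsum_homog untwist_part_linear). Qed.

Lemma untwist_neutral x : homog 1%g x -> untwist x = q x.
Proof.
move=> /untwist_homog ->; rewrite invg1 -[1%g]/(val (1%g : N)) twisted_extE.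
by rewrite /twisted_unit invg1 gamma1 (grouplike_splitting1 hu) !mulr1.
Qed.

Lemma untwist_lift_set x : lift_set J x -> untwist x = 0.
Proof.
apply: linspan0 => _ [h _ [j Jj <-]]; elim/homog_ind: h => [|g h gh].
  split=> [|c a b /= ha hb]; first by rewrite mul0r linear0.
  by rewrite mulrDl -scalerAl linearP /= ha hb scaler0 addr0.
have j1 := qhi_sub (inv_qhideal J) Jj.
rewrite /= (untwist_homog (pgM hH gh j1)).
have -> : q (h * j) = 0 by apply/qproj_eq0; apply: prodset_in.
by rewrite mul0r.
Qed.

Lemma untwist_datum x : D x -> untwist x = 0.
Proof.
apply: linspan0 => _ [a [x' [b [X ->]]]]; case: X => [Jx|[n _ <-]].
  apply: untwist_lift_set; have [_ _ Jl Jr _ _ _] := lift_set_qhideal J.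
  exact/Jr/Jl.
elim/homog_ind: a => [|g a ga].
  split=> [|c a a' /= ha ha']; first by rewrite !mul0r linear0.
  by rewrite !mulrDl -!scalerAl linearP /= ha ha' scaler0 addr0.
elim/homog_ind: b => [|h b hb].
  split=> [|c b b' /= hb hb']; first by rewrite !mulr0 linear0.
  by rewrite mulrDr -scalerAr linearP /= hb hb' scaler0 addr0.
rewrite mulrBr mulrBl linearB /=; apply/eqP; rewrite subr_eq0; apply/eqP.
have [un qun] := ut_lift n; have [gn qgn] := gt_lift n.
rewrite (untwist_homog (pgM hH (pgM hH ga un) hb)).
rewrite (untwist_homog (pgM hH (pgM hH ga gn) hb)) mulg1.
rewrite !qhprojM [q (ut n)]qun [q (gt n)]qgn gamma_twisted.
(* [v n] passes [q b] as [v n'], where [n' = h^-1 n h]. Since [n' (g n h)^-1 = (g h)^-1], the terms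
   of degrees [g n h] and [g h] take the same value. *)
pose n' := nsg_conj (h^-1)%g n.
have nn : n = nsg_conj h n'.
  by apply: val_inj; rewrite !val_nsg_conj invgK !mulgA mulgV mul1g mulgK.
have e : v n * q b * twisted_ext (g * val n * h)^-1%g = q b * twisted_ext (g * h)^-1%g.
  have qb : Qh h (q b) by exists b.
  rewrite {1}nn -(twisted_unit_conj _ qb) -[LHS]mulrA twisted_extM.
  by congr (_ * twisted_ext _); rewrite val_nsg_conj invgK !invgM !mulgA !mulgK.
by rewrite -[RHS]mulrA -e !mulrA.
Qed.

(** For [j] in [J], the neutral part of [h * j] is the neutral part of [h] times [j], which is again
    in [J]. *)
Lemma lift_set_neutral x : lift_set J x -> homog 1%g x -> inv_set J x.
Proof.
have [J1 Js Jl _ _ _ _] := inv_qhideal J.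
move=> Jx x1; have := hcomp_homog 1%g x1; rewrite eqxx => <-.
apply: linspan_image Jx => // _ [h _ [j Jj <-]] /=.
by rewrite (hcompMr _ _ (J1 _ Jj)); apply: Jl => //; exact: hcompP.
Qed.

Lemma datum_neutral : D `&` homog 1%g = J.
Proof.
apply/seteqP; split=> [x [Dx x1]|x Jx].
  apply: lift_set_neutral => //; apply/qproj_eq0.
  by rewrite -untwist_neutral // untwist_datum.
split; last exact: (qhi_sub (inv_qhideal J) Jx).
by apply: lift_set_datum; rewrite -[x]mul1r; apply: prodset_in.
Qed.

Lemma counit_q x : counit (q x) = counit x :> k.
Proof. exact: (qhquot_counitE (lift_ideal J)). Qed.

Lemma counit_twisted_ext g : counit (twisted_ext g) = (g \in N)%:R :> k.
Proof.
have [gN|gN] := boolP (g \in N); last by rewrite twisted_ext0 // linear0.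
rewrite -[g]/(val (Sub g gN : nsg_sort N)) twisted_extE /twisted_unit.
have [_ _ _ [_ g1]] := cd_grouplike gamma_datum (Sub g gN : nsg_sort N)^-1%g.
have [_ u1] := gls_grouplike hu (Sub g gN).
by rewrite rmorphM /= g1 u1 mulr1.
Qed.

Lemma counit_untwist x : counit (untwist x) =
  \sum_(p <- hdec x | p.1 \in N) (counit p.2 : k) :> k.
Proof.
have -> : counit (untwist x) =
    \sum_(p <- hdec x) counit (q p.2 * twisted_ext (p.1^-1)%g) :> k.
  exact: linear_sum.
rewrite [RHS]big_mkcond; apply: eq_bigr => p _.
rewrite rmorphM /= [counit (q _)]counit_q [counit (twisted_ext _)]counit_twisted_ext nsgV.
by case: ifP => _; rewrite ?mulr1 ?mulr0.
Qed.

Lemma counit_ut n : counit (ut n) = 1 :> k.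
Proof. by rewrite -counit_q (q_ut ut_lift); case: (gls_grouplike hu n). Qed.

Lemma counit_gt n : counit (gt n) = 1 :> k.
Proof.
by rewrite -counit_q (q_gt gt_lift); case: (cd_grouplike gamma_datum n) => _ _ _ [].
Qed.

Lemma datum_support : ideal_support D = [set g | g \in N].
Proof.
apply/seteqP; split=> [g [x Dx xg]|g /= gN].
  (* As [untwist x = 0], the counits of the parts of [x] with degree in [N] sum to 0; by
     [counit_pred] the same sum is 1 less than the truth value of [g \in N]. *)
  have := counit_pred (mem N) (g := g) (@hdecP _ _ _ x).
  rewrite -hdecE -counit_untwist (untwist_datum Dx) linear0 => /(_ xg) /=.
  have [N1 _] := nsg_closed N; rewrite N1.
  by case: (g \in N) => // /eqP; rewrite sub0r eq_sym oppr_eq0 oner_eq0.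
pose n : nsg_sort N := Sub g gN.
exists (ut n - gt n); first exact: datum_gen.
apply: grading_map_sub1; [by case: (ut_lift n)|by case: (gt_lift n)| |].
  exact: counit_ut.
exact: counit_gt.
Qed.

Lemma datum_ind (P : H -> Prop) : subspace P ->
  (forall a b x, lift_set J x \/ (exists n, x = ut n - gt n) -> P (a * x * b)) ->
  forall x, D x -> P x.
Proof.
move=> hP PX; apply: linspan_sub => // _ [a [x [b [X ->]]]]; apply: PX.
by case: X => [|[n _ <-]]; [left | right; exists n].
Qed.

Lemma datum_Delta_gen n :
  sumset (tensset D setT) (tensset setT D) (Delta (ut n - gt n)).
Proof.
set K := sumset _ _; have hK : subspace K by exact: linspan_subspace.
(* [z] equals [ut n \ot ut n - gt n \ot gt n]. The lifts are group-like only modulo J^G, so [z]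
   agrees with the coproduct after [q \ot q], and [ker_tmap] places the difference. *)
pose z := (ut n - gt n) \ot ut n + gt n \ot (ut n - gt n).
have Kz : K z.
  by apply: subspaceD => //; apply: linspan_in; [left|right]; apply: tensset_in => //;
    exact: datum_gen.
rewrite -[Delta _](subrK z); apply: subspaceD => //.
have : tmap q q (Delta (ut n - gt n) - z) = 0.
  rewrite linearB linearB linearB /= -!(qhquot_DeltaE (lift_ideal J)).
  rewrite (q_ut ut_lift) (q_gt gt_lift).
  have [uD _] := gls_grouplike hu n; have [_ _ _ [gD _]] := cd_grouplike gamma_datum n.
  rewrite [qhquot_Delta (u n)]uD [qhquot_Delta (gamma n)]gD /z linearD /= !tmapE.
  rewrite linearB /= (q_ut ut_lift) (q_gt gt_lift) tensBl tensBr addrA subrK.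
  by rewrite subrr.
move/(ker_tmap (@qhreprK _ _ _) (@qhreprK _ _ _)).
by apply: sumset_tensS => y /qproj_eq0 /lift_set_datum.
Qed.

Lemma datum_Delta x : D x -> sumset (tensset D setT) (tensset setT D) (Delta x).
Proof.
set K := sumset _ _; have hK : subspace K by exact: linspan_subspace.
move: x; apply: datum_ind => [|a b x hx].
  exact: (subspace_preim (Delta : {linear H -> (H \ot H)%type}) hK).
rewrite !rmorphM /=; apply: sumset_tens_mulr => [c y|c y|]; try exact: ideal_gen_mulr.
apply: sumset_tens_mull => [c y|c y|]; try exact: ideal_gen_mull.
case: hx => [Jx|[n ->]]; last exact: datum_Delta_gen.
have := qhi_Delta (lift_set_qhideal J) Jx.
by apply: sumset_tensS; exact: lift_set_datum.
Qed.

Lemma datum_antipode x : D x -> D (antipode x).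
Proof.
move: x; apply: datum_ind => [|a b x hx]; first exact: subspace_preim.
rewrite !antipodeM; apply: ideal_gen_mull; apply: ideal_gen_mulr.
case: hx => [Jx|[n ->]].
  by apply: lift_set_datum; exact: (qhi_antipode (lift_set_qhideal J)).
(* By [grouplike_antipode] the antipode inverts [u n] and [gamma n]; modulo J^G it thus sends the
   generator at [n] to the generator at [n^-1]. *)
have Sut : q (antipode (ut n)) = u (n^-1)%g.
  rewrite -(qhquot_antipodeE (lift_ideal J)) (q_ut ut_lift).
  apply: (grouplike_antipode hQ); last exact: (gls_comm hu).
  - by rewrite (gls_mul hu) mulgV (grouplike_splitting1 hu).
  - by rewrite (gls_mul hu) mulVg (grouplike_splitting1 hu).
  - exact: (gls_grouplike hu).
have Sgt : q (antipode (gt n)) = gamma (n^-1)%g.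
  rewrite -(qhquot_antipodeE (lift_ideal J)) (q_gt gt_lift).
  apply: (grouplike_antipode hQ); last exact: gamma_comm.
  - by rewrite -(cd_mul gamma_datum) mulgV gamma1.
  - by rewrite -(cd_mul gamma_datum) mulVg gamma1.
  - by case: (cd_grouplike gamma_datum n).
rewrite -[antipode _](subrK (ut (n^-1)%g - gt (n^-1)%g)).
apply: subspaceD => //; last exact: datum_gen.
apply: lift_set_datum; apply/qproj_eq0.
by rewrite !linearB /= Sut Sgt (q_ut ut_lift) (q_gt gt_lift) -opprD subrr.
Qed.

Lemma datum_over : ideal_over N J D.
Proof.
split; [|exact: datum_support|exact: datum_neutral].
split=> //.
- by move=> a x _; exact: ideal_gen_mull.
- by move=> a x _; exact: ideal_gen_mulr.
- exact: datum_Delta.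
- move=> x Dx; move: x Dx; apply: datum_ind => [|a b x hx].
    by split=> [|c x y /= hx hy]; rewrite ?linear0 // linearP /= hx hy scaler0 addr0.
  rewrite !rmorphM /=; case: hx => [Jx|[n ->]].
    by rewrite (qhi_counit (lift_set_qhideal J) Jx) mulr0 mul0r.
  by rewrite linearB /= [counit (ut n)]counit_ut [counit (gt n)]counit_gt subrr mulr0 mul0r.
- exact: datum_antipode.
Qed.

End DatumIdealOver.

Theorem theorem6p9 (k : fieldType) (G : groupType) (H : gradedQuasiHopf k G)
    (H_faithful : faithfully_graded H)
    (N : normalSubgroup G) (J : invIdeal H)
    (u : N -> lifted_quot J) (u_family : equivariant_family N J u)
    (ut : N -> H) (ut_lift : forall n, is_lift J (val n) (u n) (ut n))
    (gt : (N -> lifted_quot J) -> N -> H)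
    (gt_lift : forall gamma, character_datum N J gamma ->
       forall n, is_lift J 1%g (gamma n) (gt gamma n)) :
  let I_ gamma := datum_ideal N J ut (gt gamma) in
  [/\ forall gamma, character_datum N J gamma -> ideal_over N J (I_ gamma),
      forall I, ideal_over N J I ->
        exists2 tau, retraction_of N J I tau
          & forall tau', retraction_of N J I tau' ->
              forall x, quot_sub N J x -> tau' x = tau x,
      forall I tau, ideal_over N J I -> retraction_of N J I tau ->
        character_datum N J (tau \o u) /\ I_ (tau \o u) = I
    & forall gamma tau, character_datum N J gamma ->
        retraction_of N J (I_ gamma) tau -> tau \o u = gamma].
Proof.
move=> I_; split.
- move=> gamma hgamma.
  exact: (datum_over H_faithful u_family ut_lift hgamma (gt_lift _ hgamma)).
- move=> I hI; have [P hP] := over_projector H_faithful hI.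
  have hPr := projector_retraction H_faithful hI hP.
  by exists P => // tau htau x; exact: (retraction_unique hPr htau).
- move=> I tau hI htau.
  have hd := retraction_datum H_faithful u_family hI htau; split=> //.
  have gl := gt_lift _ hd; have [hqh _ _] := hI.
  have DI : I_ (tau \o u) `<=` I.
    apply: ideal_gen_sub; first exact: (qhi_subspace hqh).
    + by move=> a x; exact: (qhi_mull hqh).
    + by move=> a x; exact: (qhi_mulr hqh).
    move=> _ [/(over_lift_set hI) //|[n _ <-]].
    (* Modulo J^G the generator is [u n - tau (u n)], an element of the kernel of [tau]. *)
    apply/(over_image hI); rewrite linearB /= (q_ut ut_lift) (q_gt gl) /=.
    apply: retraction_sub_ker htau _.
    by have [hu _] := u_family; exact: quot_homog_sub (gls_degree hu n).
  apply/seteqP; split=> //.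
  exact: (ideal_over_sub_datum H_faithful ut_lift hd gl hI DI).
- move=> gamma tau hgamma.
  exact: (retraction_gamma u_family ut_lift hgamma (gt_lift _ hgamma)).
Qed.
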